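(* For each $P\in\{P_1,P_2,P_3\}$, the gap sequence of $\mathcal{X}$ at $P$ is $$G(P)=\{(i-1)(n-1)+j:\ 1\le i\le j\le n-1\},$$ and the Weierstrass semigroup $H(P)$ is generated by $S=\{s(n-1)+1:\ 1\le s\le n\}$.
   Context: Let $\mathbb{K}$ be an algebraically closed field and $n\ge 3$ an integer. $\mathcal{X}$ is a nonsingular projective plane curve over $\mathbb{K}$ of genus $g=n(n-1)/2$ with homogeneous equation $XY^{n}+YZ^{n}+ZX^{n}+XYZ\cdot G(X,Y,Z)=0$, where $G(X,Y,Z)$ is either zero or homogeneous of degree $n-2$. Put $P_1=(1:0:0)$, $P_2=(0:1:0)$, $P_3=(0:0:1)$. Let $\mathbb{N}_0$ be the set of nonnegative integers. For $P\in\mathcal{X}$, $H(P)=\{m\in\mathbb{N}_0:\exists f\in\mathbb{K}(\mathcal{X}) \text{ with pole divisor } \operatorname{div}_\infty(f)=mP\}$ is the Weierstrass semigroup at $P$, and $G(P)=\mathbb{N}_0\setminus H(P)$ is the set (sequence) of gaps at $P$. *)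

(* Defs.v *)
From HB Require Import structures.
From mathcomp Require Import all_boot all_order all_algebra.
From mathcomp.multinomials Require Import mpoly.

Set Implicit Arguments.
Unset Strict Implicit.
Unset Printing Implicit Defensive.
Import GRing.Theory.
Local Open Scope ring_scope.

Notation "x %:F" := (@FracField.tofrac _ x) : ring_scope.

(* A point (a : b : c) of the projective plane is given by a nonzero row vector
   of homogeneous coordinates; two of them define the same point iff they span
   the same line, i.e. [(P == Q)%MS]. *)
Definition hpoint (K : fieldType) (a b c : K) : 'rV[K]_3 :=
  \row_(j < 3) [:: a; b; c]`_j.

Section PlaneCurve.

Variables (K : fieldType) (F : {mpoly K[3]}).

Definition ev (A : {mpoly K[3]}) (P : 'rV[K]_3) : K := A.@[P 0].

Definition on_curve (P : 'rV[K]_3) : Prop := P != 0 /\ ev F P = 0.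

Definition nonsingular : Prop :=
  forall P, on_curve P -> exists i : 'I_3, ev (F^`M(i)) P != 0.

Definition dvd_form (A : {mpoly K[3]}) : Prop := exists C, A = C * F.

(* The function field of the curve F = 0 is the residue field, at the generic
   point of the curve, of the plane: the quotients A / B of forms of the same
   degree with F not dividing B (predicate [ratfun]), modulo those where
   moreover F divides A (predicate [ratfun_zero]).  A rational function is
   thus represented by an element f of K(X, Y, Z) such that [ratfun f], and
   equality of rational functions is [ratfun_eq]. *)

Definition form_quotient (f : {fraction {mpoly K[3]}}) (A B : {mpoly K[3]}) :
    Prop :=
  (exists2 d, A \is d.-homog & B \is d.-homog) /\ f = A%:F / B%:F.

Definition ratfun (f : {fraction {mpoly K[3]}}) : Prop :=
  exists A B, form_quotient f A B /\ ~ dvd_form B.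

Definition ratfun_zero (f : {fraction {mpoly K[3]}}) : Prop :=
  exists A B, [/\ form_quotient f A B, ~ dvd_form B & dvd_form A].

Definition ratfun_eq (f g : {fraction {mpoly K[3]}}) : Prop :=
  ratfun_zero (f - g).

(* Elements, elements of the maximal ideal, and units of the local ring of the
   plane at P.  The local ring of the curve at a point P of the curve is the
   image of this ring in the function field, i.e. its quotient by
   [ratfun_eq]. *)

Definition local_ring (P : 'rV[K]_3) (f : {fraction {mpoly K[3]}}) : Prop :=
  exists A B, form_quotient f A B /\ ev B P != 0.

Definition local_max (P : 'rV[K]_3) (f : {fraction {mpoly K[3]}}) : Prop :=
  exists A B, [/\ form_quotient f A B, ev B P != 0 & ev A P = 0].

Definition local_unit (P : 'rV[K]_3) (f : {fraction {mpoly K[3]}}) : Prop :=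
  exists A B, [/\ form_quotient f A B, ev B P != 0 & ev A P != 0].

Definition regular_at (P : 'rV[K]_3) (f : {fraction {mpoly K[3]}}) : Prop :=
  exists2 g, local_ring P g & ratfun_eq f g.

Definition uniformizer (P : 'rV[K]_3) (t : {fraction {mpoly K[3]}}) : Prop :=
  local_max P t /\
  forall g, local_max P g -> exists2 h, local_ring P h & ratfun_eq g (t * h).

(* v_P(f) = m, for f nonzero in the function field. *)
Definition has_order (P : 'rV[K]_3) (f : {fraction {mpoly K[3]}}) (m : int) :
    Prop :=
  exists t u, [/\ uniformizer P t, local_unit P u & ratfun_eq f (u * t ^ m)].

(* k is the coefficient of P in the pole divisor of f. *)
Definition pole_mult (P : 'rV[K]_3) (f : {fraction {mpoly K[3]}}) (k : nat) :
    Prop :=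
  (k = 0%N /\ regular_at P f) \/ ((0 < k)%N /\ has_order P f (- k%:Z)).

Definition pole_divisor (f : {fraction {mpoly K[3]}}) (D : 'rV[K]_3 -> nat) :
    Prop :=
  forall Q, on_curve Q -> pole_mult Q f (D Q).

Definition mult_point (m : nat) (P : 'rV[K]_3) : 'rV[K]_3 -> nat :=
  fun Q => if (P == Q)%MS then m else 0%N.

Definition weierstrass_semigroup (P : 'rV[K]_3) (m : nat) : Prop :=
  exists2 f, ratfun f & pole_divisor f (mult_point m P).

Definition gap (P : 'rV[K]_3) (m : nat) : Prop := ~ weierstrass_semigroup P m.

End PlaneCurve.

(* The smallest subset of the nonnegative integers containing S and 0 and
   closed under addition. *)
Inductive generated (S : nat -> Prop) : nat -> Prop :=
| generated0 : generated S 0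
| generated_in m : S m -> generated S m
| generatedD m p : generated S m -> generated S p -> generated S (m + p).

Definition curve_eq (K : fieldType) (n : nat) (G : {mpoly K[3]}) :
    {mpoly K[3]} :=
  let X := 'X_(0 : 'I_3) in let Y := 'X_(1 : 'I_3) in
  let Z := 'X_(2 : 'I_3) in
  X * Y ^+ n + Y * Z ^+ n + Z * X ^+ n + X * Y * Z * G.

(* Main.v *)
Require Import Defs.
From HB Require Import structures.
From mathcomp Require Import all_boot all_order all_algebra.
From mathcomp.multinomials Require Import mpoly.
From mathcomp Require Import zify ring.

Set Implicit Arguments.
Unset Strict Implicit.
Unset Printing Implicit Defensive.
Import GRing.Theory.
Local Open Scope ring_scope.

(* Let (X : Y : Z) be cyclically permuted so that P = (1 : 0 : 0).  With
   x = X/Z and y = Y/Z, the monomial x^a y^b has order -(n a + (n-1) b) at P and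
   (n-1) a - b at (0 : 1 : 0), which gives enough functions: X Y^(s-1) / Z^s has
   pole divisor (s (n-1) + 1) P.

   Conversely, a function with poles only at P is regular on the chart Z <> 0,
   hence, by the Nullstellensatz applied to its ideal of denominators, is a
   polynomial in x and y.  Eliminating the leading monomial x y^n of the
   equation writes it as a combination of the y^b and of the x^a y^b with a > 0
   and b < n.  The y^b with b > 0 have distinct poles at (0 : 1 : 0), where the
   other monomials are regular, so they do not occur; the remaining monomials
   have distinct pole orders n a + (n-1) b at P, so the pole order of the
   function is one of these numbers.

   Orders are computed by substituting into forms polynomial approximations of
   the power series parametrization X = 1, Y = z, Z = - z^n + ... of the branch
   at P.  The same substitution, at a point where the monomials that remain
   after elimination have distinct orders, shows that the equation generates a
   prime ideal. *)

(** * Arithmetic of the semigroup and of its gaps *)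

(* [n a + (n - 1) b] is the pole order at (1 : 0 : 0) of [X^a Y^b / Z^(a+b)],
   a function regular at (0 : 1 : 0) iff [b <= (n - 1) a]. *)
Definition monomial_pole (n m : nat) : Prop :=
  exists a b : nat, (b <= (n - 1) * a)%N /\ m = (n * a + (n - 1) * b)%N.

(** The generator [s (n - 1) + 1] is the value at [a = 1], [b = s - 1]. Conversely, each unit of [a]
    supplies one generator, which absorbs up to [n - 1] units of [b]. *)
Lemma generated_monomial_pole (n m : nat) : (3 <= n)%N ->
  generated
    (fun k => exists s : nat, (1 <= s <= n)%N /\ k = (s * (n - 1) + 1)%N) m <->
  monomial_pole n m.
Proof.
move=> n_ge3; split.
  elim=> [|{}m [s [s_range ->]]|p q _ [a [b [le_b ->]]] _ [c [d [le_d ->]]]].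
  - by exists 0%N, 0%N; split; lia.
  - by exists 1%N, (s - 1)%N; split; nia.
  - by exists (a + c)%N, (b + d)%N; split; nia.
case=> a [b [le_b ->]]; elim: a b le_b => [|a IHa] b le_b.
  have ->: b = 0%N by lia.
  by rewrite !muln0; apply: generated0.
have [c [le_c le_cb le_bc]] :
    exists c, [/\ (c <= n - 1)%N, (c <= b)%N & (b - c <= (n - 1) * a)%N].
  by exists (minn b (n - 1)); split; nia.
have ->: (n * a.+1 + (n - 1) * b =
          (c.+1 * (n - 1) + 1) + (n * a + (n - 1) * (b - c)))%N by nia.
apply: generatedD; last exact: IHa.
by apply: generated_in; exists c.+1; split; lia.
Qed.

(** The pole order is [(n - 1) (a + b) + a]. For [m > 0] write [m = q (n - 1) + j] with
    [1 <= j <= n - 1]: [m] is a pole order iff [j <= q], and a gap has [i = q + 1]. *)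
Lemma not_monomial_pole (n m : nat) : (3 <= n)%N ->
  ~ monomial_pole n m <->
  exists i j : nat,
    (1 <= i <= j)%N /\ (j <= n - 1)%N /\ m = ((i - 1) * (n - 1) + j)%N.
Proof.
move=> n_ge3; split=> [no_ab | [i [j [ij_range [le_j ->]]]] [a [b [le_b eq_ab]]]].
  have [m0|m_gt0] := posnP m.
    by case: no_ab; exists 0%N, 0%N; split; lia.
  pose q := (m.-1 %/ (n - 1))%N; pose j := (m.-1 %% (n - 1)).+1.
  have def_m : m = (q * (n - 1) + j)%N.
    by rewrite /j addnS -divn_eq prednK.
  have j_le : (j <= n - 1)%N by rewrite /j ltn_mod; lia.
  have [lt_qj|le_jq] := ltnP q j.
    by exists q.+1, j; split; [lia | split; [lia | rewrite subn1]].
  (* [a] must be congruent to [j] modulo [n - 1]; putting [a = j + (n - 1) l] into [q = a + b + l]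
     leaves [q - j = n l + b]. *)
  case: no_ab; pose l := ((q - j) %/ n)%N; pose b := ((q - j) %% n)%N.
  have def_q : (q = j + l * n + b)%N.
    by rewrite -addnA -divn_eq; lia.
  have b_lt : (b < n)%N by rewrite ltn_mod; lia.
  have j_gt0 : (0 < j)%N by [].
  exists (j + (n - 1) * l)%N, b; split; first nia.
  rewrite def_m def_q -(subnK (ltnW (ltnW n_ge3))) addnK; ring.
(* If [0 < a < j], then [j - a] would be a multiple of [n - 1] strictly between 0 and [n - 1]; if
   [j <= a], the pole order is too large. *)
have [lt_aj|le_ja] := ltnP a j.
  have a_gt0 : (0 < a)%N by case: (a) eq_ab le_b; nia.
  have: (j - a = (n - 1) * (a + b + 1 - i))%N \/ (a + b + 1 < i)%N by nia.
  nia.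
nia.
Qed.

(** * Valuation at 0 of univariate polynomials *)

Definition vanishes (K : fieldType) (N : nat) (p : {poly K}) : Prop :=
  forall l, (l < N)%N -> p`_l = 0.

(** The valuation at 0, as a relation, so that 0 has no order; [vanishes N (p - q)] is congruence
    modulo [X^N]. *)
Definition order0 (K : fieldType) (p : {poly K}) (m : nat) : Prop :=
  p`_m != 0 /\ vanishes m p.

Section Order0.

Variable K : fieldType.
Implicit Types (p q : {poly K}) (m N : nat).

Lemma vanishesD N p q : vanishes N p -> vanishes N q -> vanishes N (p + q).
Proof. by move=> p0 q0 l lt_l; rewrite coefD p0 // q0 // addr0. Qed.

Lemma vanishesN N p : vanishes N p -> vanishes N (- p).
Proof. by move=> p0 l lt_l; rewrite coefN p0 // oppr0. Qed.

Lemma vanishesM N M p q :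
  vanishes N p -> vanishes M q -> vanishes (N + M) (p * q).
Proof.
move=> p0 q0 l lt_l; rewrite coefM big1 // => a _.
have [lt_aN|le_Na] := ltnP a N; first by rewrite p0 // mul0r.
by rewrite q0 ?mulr0 //; have := ltn_ord a; lia.
Qed.

Lemma vanishesMr N p q : vanishes N p -> vanishes N (p * q).
Proof. by move=> p0; rewrite -[N]addn0; apply: vanishesM. Qed.

Lemma vanishesMl N p q : vanishes N q -> vanishes N (p * q).
Proof. by rewrite mulrC; apply: vanishesMr. Qed.

Lemma vanishesW N M p : (M <= N)%N -> vanishes N p -> vanishes M p.
Proof. by move=> le_MN p0 l lt_l; apply: p0; apply: leq_trans lt_l le_MN. Qed.

Lemma vanishesX : vanishes 1 ('X : {poly K}).
Proof. by case=> // _; rewrite coefX. Qed.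

Lemma vanishesXn N : vanishes N ('X^N : {poly K}).
Proof. by move=> l lt_l; rewrite coefXn ltn_eqF. Qed.

Lemma vanishes_lt N p m : vanishes N p -> order0 p m -> (N <= m)%N.
Proof. by move=> p0 [pm _]; rewrite leqNgt; apply: contra_neqN pm => /p0. Qed.

Lemma order0_uniq p m1 m2 : order0 p m1 -> order0 p m2 -> m1 = m2.
Proof.
move=> o1 o2; apply/eqP; rewrite eqn_leq.
by rewrite (vanishes_lt o1.2 o2) (vanishes_lt o2.2 o1).
Qed.

Lemma order0_cong N p q m :
  order0 p m -> vanishes N (p - q) -> (m < N)%N -> order0 q m.
Proof.
move=> [pm p0] pq0 lt_mN; have pqE l : (l < N)%N -> q`_l = p`_l.
  by move=> /pq0; rewrite coefB => /subr0_eq ->.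
split=> [|l lt_lm]; first by rewrite pqE.
by rewrite pqE ?p0 //; apply: ltn_trans lt_lm lt_mN.
Qed.

Lemma order0M p q m1 m2 :
  order0 p m1 -> order0 q m2 -> order0 (p * q) (m1 + m2).
Proof.
move=> [pm p0] [qm q0]; split; last exact: vanishesM.
have lt_m : (m1 < (m1 + m2).+1)%N by rewrite ltnS leq_addr.
rewrite coefM (bigD1 (Ordinal lt_m)) //= big1 ?addr0 => [|a ne_a].
  by rewrite addKn mulf_neq0.
have [lt_a|le_a] := ltnP a m1; first by rewrite p0 // mul0r.
rewrite q0 ?mulr0 //; move: ne_a; rewrite -val_eqE /=.
by have := ltn_ord a; lia.
Qed.

Lemma order0C p : order0 p 0 <-> p`_0 != 0.
Proof. by split=> [[]|] //. Qed.

Lemma order0_1 : order0 (1 : {poly K}) 0.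
Proof. by apply/order0C; rewrite coef1 oner_neq0. Qed.

Lemma order0X : order0 ('X : {poly K}) 1.
Proof. by split; [rewrite coefX oner_neq0 | apply: vanishesX]. Qed.

Lemma order0_exp p m a : order0 p m -> order0 (p ^+ a) (m * a).
Proof.
move=> om; elim: a => [|a IHa]; first by rewrite muln0 expr0; apply: order0_1.
by rewrite exprS mulnS; apply: order0M.
Qed.

Lemma order0Z c p m : c != 0 -> order0 p m -> order0 (c *: p) m.
Proof.
move=> c0 [pm p0]; split=> [|l lt_l]; rewrite coefZ; first by rewrite mulf_neq0.
by rewrite p0 // mulr0.
Qed.

(** The term of least order cannot cancel. It is chosen before [g], so it serves every family with
    these orders. *)
Lemma order0_sum (T : eqType) (s : seq T) (o : T -> nat) :
    uniq s -> {in s &, injective o} -> s != [::] ->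
  exists2 t, t \in s &
    forall g : T -> {poly K}, (forall u, u \in s -> order0 (g u) (o u)) ->
      order0 (\sum_(u <- s) g u) (o t).
Proof.
move=> uniq_s inj_o s_neq0.
have [t t_in t_min] : exists2 t, t \in s & forall u, u \in s -> (o t <= o u)%N.
  elim: s s_neq0 {uniq_s inj_o} => // a [|b s] IHs _.
    by exists a; rewrite ?mem_head // => u; rewrite inE => /eqP->.
  have [//|t t_in t_min] := IHs.
  have [le_at|/ltnW le_ta] := leqP (o a) (o t).
    exists a; rewrite ?mem_head // => u; rewrite inE => /predU1P[->//|/t_min].
    exact: leq_trans.
  by exists t => [|u]; rewrite inE ?t_in ?orbT // => /predU1P[->|/t_min].
exists t => // g og; split=> [|l lt_l]; rewrite coef_sum.
  rewrite (bigD1_seq t) //= big_seq_cond big1 ?addr0; first by case: (og t t_in).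
  move=> u /andP[u_in ne_ut]; apply: (og u u_in).2.
  rewrite ltn_neqAle t_min // andbT; apply: contra_neq ne_ut => eq_o.
  exact: inj_o.
rewrite big_seq big1 // => u u_in; apply: (og u u_in).2.
by apply: leq_trans lt_l _; apply: t_min.
Qed.

End Order0.

(** * Three variables in any order, and homogeneity *)

Definition coords3 (S : Type) (i j : 'I_3) (a b c : S) : 'I_3 -> S :=
  fun l => if l == i then a else if l == j then b else c.

Section ThreeVariables.

Variables (i j k : 'I_3).
Hypothesis ijk_uniq : uniq [:: i; j; k].

Lemma ord3E (l : 'I_3) : [\/ l = i, l = j | l = k].
Proof.
have sub_enum : {subset [:: i; j; k] <= enum 'I_3} by move=> x; rewrite mem_enum.
have [|_ mem_ijk] := uniq_min_size ijk_uniq sub_enum; first by rewrite size_enum_ord.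
have: l \in [:: i; j; k] by rewrite mem_ijk mem_enum.
by rewrite !inE => /or3P[]/eqP->; [constructor 1|constructor 2|constructor 3].
Qed.

Lemma ord3_neq : [/\ i != j, i != k & j != k].
Proof. by move: ijk_uniq; rewrite /= !inE negb_or; case/and3P => /andP[-> ->] ->. Qed.

Lemma coords3E (S : Type) (a b c : S) :
  (coords3 i j a b c i = a) * (coords3 i j a b c j = b) *
  (coords3 i j a b c k = c).
Proof.
have [ij ik jk] := ord3_neq; rewrite /coords3 !eqxx.
by rewrite eq_sym (negPf ij) eq_sym (negPf ik) eq_sym (negPf jk).
Qed.

Lemma big_ord3 (R : Type) (idx : R) (op : Monoid.com_law idx) (f : 'I_3 -> R) :
  \big[op/idx]_l f l = op (op (f i) (f j)) (f k).
Proof.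
have [ij ik jk] := ord3_neq.
rewrite (bigD1 i) //= (bigD1 j) 1?eq_sym //= (bigD1 k); last first.
  by rewrite eq_sym ik eq_sym jk.
rewrite big1 /= ?Monoid.mulm1 ?Monoid.mulmA // => l /andP[/andP[li lj] lk].
by case: (ord3E l) li lj lk => ->; rewrite eqxx.
Qed.

Lemma mdeg3 (m : 'X_{1..3}) : mdeg m = (m i + m j + m k)%N.
Proof. by rewrite mdegE big_ord3. Qed.

Lemma mmap1_3 (S : comNzRingType) (h : 'I_3 -> S) (m : 'X_{1..3}) :
  mmap1 h m = h i ^+ m i * h j ^+ m j * h k ^+ m k.
Proof. by rewrite /mmap1 big_ord3. Qed.

Lemma mpolyX3 (R : comNzRingType) (m : 'X_{1..3}) :
  'X_[m] = 'X_i ^+ m i * 'X_j ^+ m j * 'X_k ^+ m k :> {mpoly R[3]}.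
Proof. by rewrite mpolyXE_id big_ord3. Qed.

Lemma mnm3P (m1 m2 : 'X_{1..3}) :
  m1 i = m2 i -> m1 j = m2 j -> m1 k = m2 k -> m1 = m2.
Proof. by move=> ei ej ek; apply/mnmP => l; case: (ord3E l) => ->. Qed.

End ThreeVariables.

Section Homogeneity.

Variables (R : idomainType).
Implicit Types (p q : {mpoly R[3]}) (d e : nat).

Lemma dhomogXU (l : 'I_3) : ('X_l : {mpoly R[3]}) \is 1.-homog.
Proof. by rewrite dhomogX /= mdeg1. Qed.

Lemma dhomogM_eq p q d e c : p \is d.-homog -> q \is e.-homog ->
  (d + e)%N = c -> p * q \is c.-homog.
Proof. by move=> hp hq <-; apply: dhomogM. Qed.

Lemma dhomogXn_eq p d e a : p \is d.-homog -> (d * a)%N = e ->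
  p ^+ a \is e.-homog.
Proof. by move=> hp <-; apply: dhomogMn. Qed.

Lemma dhomogN_eq p d : p \is d.-homog -> - p \is d.-homog.
Proof. by rewrite dhomogN. Qed.

End Homogeneity.

(* The context is cleared because [lia] is very slow when it contains
   hypotheses about polynomials. *)
Ltac nat_lia :=
  repeat match goal with
  | H : ?T |- _ =>
      lazymatch T with
      | is_true (leq _ _) => fail
      | @eq nat _ _ => fail
      | nat => fail
      | _ => clear H
      end
  end; lia.

Ltac solve_homog :=
  match goal with
  | H : is_true (?p \is _) |- is_true (?p \is _) => exact: H
  | |- is_true (0 \is _) => exact: dhomog0
  | |- is_true (1 \is _) => exact: dhomog1
  | |- is_true (mpolyX _ (mnm1 _) \is _) => exact: dhomogXU
  | |- is_true (_ + _ \is _) => apply: dhomogD; [solve_homog | solve_homog]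
  | |- is_true (- _ \is _) => apply: dhomogN_eq; solve_homog
  | |- is_true (_ *: _ \is _) => apply: dhomogZ; solve_homog
  | |- is_true (_ * _ \is _) =>
      eapply dhomogM_eq; [solve_homog | solve_homog | try nat_lia; try reflexivity]
  | |- is_true (_ ^+ _ \is _) =>
      eapply dhomogXn_eq; [solve_homog | try nat_lia; try reflexivity]
  end.

(** * Substitution of an approximate branch into forms *)

Section Branch.

Variables (K : fieldType) (n : nat).
Hypothesis n_ge3 : (3 <= n)%N.

(** Restriction of forms to the arc [(1 : t : psi(t))]. Each use fixes a finite precision, so [psi]
    is a polynomial instead of a power series. *)
Definition at_branch (i j : 'I_3) (psi : {poly K}) : {mpoly K[3]} -> {poly K} :=
  mmap (@polyC K) (coords3 i j 1 'X psi).

HB.instance Definition _ i j psi :=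
  GRing.RMorphism.copy (at_branch i j psi)
    (mmap (@polyC K) (coords3 i j 1 'X psi)).

Lemma vanishes_cong_prod N (p p' q q' : {poly K}) :
  vanishes N (p - p') -> vanishes N (q - q') -> vanishes N (p * q - p' * q').
Proof.
move=> Hp Hq; have ->: p * q - p' * q' = (p - p') * q + p' * (q - q') by ring.
by apply: vanishesD; [apply: vanishesMr | apply: vanishesMl].
Qed.

Lemma vanishes_cong_exp N (p p' : {poly K}) a :
  vanishes N (p - p') -> vanishes N (p ^+ a - p' ^+ a).
Proof. by move=> Hp; rewrite subrXX; apply: vanishesMr. Qed.

Lemma at_branch_cong i j N (psi phi : {poly K}) A :
    vanishes N (psi - phi) ->
  vanishes N (at_branch i j psi A - at_branch i j phi A).
Proof.
move=> cong; have V0 : vanishes N (0 : {poly K}) by move=> l _; rewrite coef0.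
rewrite /at_branch /mmap -sumrB; elim/big_ind: _ => //; first exact: vanishesD.
move=> m _; rewrite -mulrBr; apply: vanishesMl.
rewrite /mmap1; elim/big_rec2: _ => [|l p q _ IH]; first by rewrite subrr.
apply: vanishes_cong_prod => //; apply: vanishes_cong_exp.
by rewrite /coords3; case: ifP => _; [|case: ifP => _]; rewrite ?subrr.
Qed.

Variables i j k : 'I_3.
Hypothesis ijk_uniq : uniq [:: i; j; k].

Lemma at_branchX psi :
  (at_branch i j psi 'X_i = 1) * (at_branch i j psi 'X_j = 'X) *
  (at_branch i j psi 'X_k = psi).
Proof.
by rewrite /at_branch !mmapX !mmap1U !(coords3E ijk_uniq).
Qed.

Lemma at_branch_monomial psi (m : 'X_{1..3}) : order0 psi n ->
  order0 (at_branch i j psi 'X_[m]) (m j + n * m k).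
Proof.
move=> opsi; rewrite (mpolyX3 ijk_uniq) !rmorphM !rmorphXn /= !at_branchX.
rewrite expr1n mul1r; apply: order0M; last exact: order0_exp.
by rewrite -[X in order0 _ X]mul1n; apply/order0_exp/order0X.
Qed.

Lemma at_branch_sum psi A :
  at_branch i j psi A =
  \sum_(m <- msupp A) A@_m *: at_branch i j psi 'X_[m].
Proof.
rewrite {1}[A]mpolyE rmorph_sum /=; apply: eq_bigr => m _.
by rewrite /at_branch mmapZ mul_polyC.
Qed.

(** The monomial [m] depends on [A] alone, so [psi] can be chosen afterwards, with a precision
    beyond this order. *)
Lemma at_branch_order A : A != 0 ->
    {in msupp A &, injective (fun m : 'X_{1..3} => m j + n * m k)%N} ->
  exists2 m, m \in msupp A &
    forall psi, order0 psi n -> order0 (at_branch i j psi A) (m j + n * m k).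
Proof.
move=> A0 inj; have [|m m_in Hm] := order0_sum K (msupp_uniq A) inj.
  by rewrite msupp_eq0.
exists m => // psi opsi; rewrite at_branch_sum; apply: Hm => u u_in.
by apply: order0Z; [rewrite -mcoeff_msupp | apply: at_branch_monomial].
Qed.

(** The arc passes through [P] at [t = 0]; rescaling its coordinate 1 to [P 0 i] gives the power of
    [P 0 i]. *)
Lemma ev_at_branch A (P : 'rV[K]_3) psi d : A \is d.-homog -> order0 psi n ->
  P 0 j = 0 -> P 0 k = 0 -> ev A P = (at_branch i j psi A)`_0 * P 0 i ^+ d.
Proof.
move=> Ad opsi Pj Pk; rewrite at_branch_sum coef_sum mulr_suml /ev mevalE.
apply: eq_big_seq => m m_in; rewrite coefZ -mulrA; congr (_ * _).
have := dhomogP _ _ _ Ad m m_in; rewrite /= (mdeg3 ijk_uniq) => deg_m.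
rewrite (big_ord3 ijk_uniq) /= Pj Pk.
have [m0|m0] := posnP (m j + n * m k).
  have [mj mk] : m j = 0%N /\ m k = 0%N by nia.
  rewrite (mpolyX3 ijk_uniq) mj mk !rmorphM !rmorphXn /= !at_branchX.
  by rewrite expr1n !expr0 !mulr1 coef1 mul1r -deg_m mj mk !addn0.
have [_ ->] := at_branch_monomial m opsi; rewrite // mul0r.
have [mj|mj] := posnP (m j); last by rewrite expr0n gtn_eqF //= mulr0 mul0r.
have [mk|mk] := posnP (m k); last by rewrite (expr0n _ (m k)) gtn_eqF //= mulr0.
by rewrite mj mk muln0 in m0.
Qed.

Lemma at_branch_unit A (P : 'rV[K]_3) psi d : A \is d.-homog -> order0 psi n ->
  P 0 j = 0 -> P 0 k = 0 -> ev A P != 0 -> order0 (at_branch i j psi A) 0.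
Proof.
move=> Ad opsi Pj Pk AP; apply/order0C; apply: contra_neq AP => A0.
by rewrite (ev_at_branch Ad opsi) // A0 mul0r.
Qed.

Lemma at_branch_vanish A (P : 'rV[K]_3) psi d : A \is d.-homog -> order0 psi n ->
  P 0 i != 0 -> P 0 j = 0 -> P 0 k = 0 -> ev A P = 0 ->
  vanishes 1 (at_branch i j psi A).
Proof.
move=> Ad opsi Pi Pj Pk AP [|//] _; apply/eqP.
move: AP; rewrite (ev_at_branch Ad opsi) // => /eqP.
by rewrite mulf_eq0 expf_eq0 (negPf Pi) andbF orbF.
Qed.

End Branch.

(** * The equation and its branch at a coordinate point *)

Section Curve.

Variables (K : fieldType) (n : nat) (G : {mpoly K[3]}).
Hypothesis n_ge3 : (3 <= n)%N.
Hypothesis G_homog : G \is (n - 2).-homog.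

(* The curve is invariant in form under cyclic permutations of the variables:
   the three points are treated at once as the point where only [X_i] is
   nonzero, for [(i, j, k)] cyclic. *)
Definition cyclic_eq (i j k : 'I_3) : {mpoly K[3]} :=
  'X_i * 'X_j ^+ n + 'X_j * 'X_k ^+ n + 'X_k * 'X_i ^+ n + 'X_i * 'X_j * 'X_k * G.

Lemma cyclic_eq_rot i j k : cyclic_eq j k i = cyclic_eq i j k.
Proof. by rewrite /cyclic_eq; ring. Qed.

Lemma cyclic_eq_homog i j k : cyclic_eq i j k \is (n.+1).-homog.
Proof. by rewrite /cyclic_eq; solve_homog. Qed.

Variables i j k : 'I_3.
Hypothesis ijk_uniq : uniq [:: i; j; k].

Let F := cyclic_eq i j k.

(* Along the branch at [X_i = 1, X_j = X_k = 0], [X_k] is a power series in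
   the parameter [X_j]; [psi] is an approximation of it. *)
Lemma branch_exists N :
  exists2 psi, order0 psi n & vanishes N (at_branch i j psi F).
Proof.
(* The branch is the fixed point of [Phi]. Its terms that depend on [phi] carry a factor [X], so
   each iteration gains one order of precision. *)
pose Phi (phi : {poly K}) :=
  - ('X^n + 'X * phi ^+ n + 'X * phi * at_branch i j phi G).
have FE phi : at_branch i j phi F = phi - Phi phi.
  rewrite /F /cyclic_eq !rmorphD !rmorphM !rmorphXn /= !(at_branchX ijk_uniq) /Phi.
  by rewrite expr1n; ring.
have ordPhi phi : vanishes n phi -> order0 (Phi phi) n.
  move=> phi_n; apply: (@order0_cong _ n.+1 (-1 *: 'X^n)) => //.
    apply: order0Z; first by rewrite oppr_eq0 oner_eq0.
    by rewrite -[n in order0 _ n]mul1n; apply/order0_exp/order0X.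
  have ->: -1 *: 'X^n - Phi phi =
      'X * (phi * (phi ^+ n.-1 + at_branch i j phi G)).
    rewrite /Phi scaleN1r mulrDr -exprS prednK; last by lia.
    by ring.
  rewrite -add1n; apply: vanishesM (@vanishesX _) _.
  exact: vanishesMr.
have [psi psi_n psi_N] :
    exists2 psi, vanishes n psi & vanishes N (at_branch i j psi F).
  elim: N => [|N [psi psi_n psi_N]].
    by exists 0 => // l _; rewrite coef0.
  exists (Phi psi); first by case: (ordPhi psi psi_n).
  have ->: at_branch i j (Phi psi) F = Phi psi - Phi (Phi psi) by rewrite FE.
  have cong : vanishes N (psi - Phi psi) by rewrite -FE.
  set phi := Phi psi in cong *.
  have ->: phi - Phi phi = 'X * ((phi ^+ n - psi ^+ n) +
      (phi * at_branch i j phi G - psi * at_branch i j psi G)).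
    by rewrite {1}/phi /Phi; ring.
  rewrite -add1n; apply: vanishesM (@vanishesX _) _.
  have cong' : vanishes N (phi - psi) by rewrite -opprB; apply: vanishesN.
  apply: vanishesD; first exact: vanishes_cong_exp.
  by apply: vanishes_cong_prod => //; apply: at_branch_cong.
(* One more iteration turns order at least [n] into order exactly [n], the leading term being
   [- X^n]. *)
exists (Phi psi); first exact: ordPhi.
have ->: at_branch i j (Phi psi) F =
     (at_branch i j (Phi psi) F - at_branch i j psi F) + at_branch i j psi F.
  by rewrite subrK.
apply: vanishesD => //; apply: at_branch_cong.
by rewrite -opprB -FE; apply: vanishesN.
Qed.

End Curve.

(** * Divisibility by the equation *)

Section DvdForm.

Variables (K : fieldType) (F : {mpoly K[3]}).
Implicit Types A B : {mpoly K[3]}.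

Lemma dvd_form0 : dvd_form F 0.
Proof. by exists 0; rewrite mul0r. Qed.

Lemma dvd_form_id : dvd_form F F.
Proof. by exists 1; rewrite mul1r. Qed.

Lemma dvd_formD A B : dvd_form F A -> dvd_form F B -> dvd_form F (A + B).
Proof. by move=> [Q ->] [Q' ->]; exists (Q + Q'); rewrite mulrDl. Qed.

Lemma dvd_formMl A B : dvd_form F B -> dvd_form F (A * B).
Proof. by move=> [Q ->]; exists (A * Q); rewrite mulrA. Qed.

Lemma dvd_formMr A B : dvd_form F A -> dvd_form F (A * B).
Proof. by rewrite mulrC; apply: dvd_formMl. Qed.

Lemma dvd_formN A : dvd_form F A -> dvd_form F (- A).
Proof. by rewrite -mulN1r; apply: dvd_formMl. Qed.

Lemma dvd_formB A B : dvd_form F A -> dvd_form F B -> dvd_form F (A - B).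
Proof. by move=> FA FB; apply: dvd_formD => //; apply: dvd_formN. Qed.

Lemma dvd_form_ev A (P : 'rV[K]_3) : ev F P = 0 -> dvd_form F A -> ev A P = 0.
Proof. by move=> FP [Q ->]; rewrite /ev mevalM -/(ev F P) FP mulr0. Qed.

End DvdForm.

(** * Degree in one variable *)

Section PartialDegree.

Variables (K : fieldType) (l : 'I_3).
Implicit Types (A B : {mpoly K[3]}) (b c : nat).

Definition deg_le b A : Prop := forall m, m \in msupp A -> (m l <= b)%N.

Lemma deg_leW b c A : (b <= c)%N -> deg_le b A -> deg_le c A.
Proof. by move=> le_bc Ab m /Ab le_mb; apply: leq_trans le_bc. Qed.

Lemma deg_leD b A B : deg_le b A -> deg_le b B -> deg_le b (A + B).
Proof. by move=> Ab Bb m /msuppD_le; rewrite mem_cat => /orP[/Ab|/Bb]. Qed.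

Lemma deg_leN b A : deg_le b A -> deg_le b (- A).
Proof. by move=> Ab m; rewrite (perm_mem (msuppN A)) => /Ab. Qed.

Lemma deg_leM b c A B : deg_le b A -> deg_le c B -> deg_le (b + c) (A * B).
Proof.
move=> Ab Bc m /msuppM_le /allpairsP[[m1 m2] /= [/Ab le1 /Bc le2 ->]].
by rewrite mnmDE leq_add.
Qed.

Lemma deg_leX l' : deg_le (l' == l) 'X_l'.
Proof. by move=> m; rewrite msuppX inE => /eqP->; rewrite mnm1E. Qed.

Lemma deg_le1 : deg_le 0 1.
Proof. by move=> m; rewrite msupp1 inE => /eqP->; rewrite mnm0E. Qed.

Lemma deg_leXn b a A : deg_le b A -> deg_le (b * a) (A ^+ a).
Proof.
move=> Ab; elim: a => [|a IHa]; first by rewrite expr0; apply/deg_leW/deg_le1.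
by rewrite exprS mulnS; apply: deg_leM.
Qed.

Lemma deg_le_homog d A : A \is d.-homog -> deg_le d A.
Proof.
move=> /dhomogP Ad m /Ad /= <-; rewrite mdegE (bigD1 l) //=.
exact: leq_addr.
Qed.

End PartialDegree.

(** * Normal forms modulo the equation, and its primality *)

Section NormalForm.

Variables (K : fieldType) (n : nat) (G : {mpoly K[3]}).
Hypothesis n_ge3 : (3 <= n)%N.
Hypothesis G_homog : G \is (n - 2).-homog.

Variables i j k : 'I_3.
Hypothesis ijk_uniq : uniq [:: i; j; k].

Let F := cyclic_eq n G i j k.
Implicit Types (A B C R : {mpoly K[3]}) (V : 'X_{1..3} -> Prop).

Definition form_over V d R : Prop :=
  R \is d.-homog /\ forall m, m \in msupp R -> V m.

Definition reduces V d A : Prop :=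
  exists2 R, form_over V d R & dvd_form F (A - R).

Lemma form_overD V d R R' :
  form_over V d R -> form_over V d R' -> form_over V d (R + R').
Proof.
move=> [Rd RV] [Rd' RV']; split; first exact: dhomogD.
by move=> m /msuppD_le; rewrite mem_cat => /orP[/RV|/RV'].
Qed.

Lemma form_overZ V d c R : form_over V d R -> form_over V d (c *: R).
Proof.
by move=> [Rd RV]; split=> [|m /msuppZ_le /RV]; first exact: dhomogZ.
Qed.

Lemma reducesW V V' d A : (forall m, V m -> V' m) ->
  reduces V d A -> reduces V' d A.
Proof. by move=> VV' [R [Rd RV] FR]; exists R => //; split=> // m /RV /VV'. Qed.

Lemma reduces_id V d A : form_over V d A -> reduces V d A.
Proof. by exists A => //; rewrite subrr; apply: dvd_form0. Qed.

Lemma reducesX V (m : 'X_{1..3}) : V m -> reduces V (mdeg m) 'X_[m].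
Proof.
move=> Vm; apply: reduces_id; split; first by rewrite dhomogX.
by move=> m'; rewrite msuppX inE => /eqP->.
Qed.

Lemma reduces_sum V d A B :
    (forall m, m \in msupp A -> reduces V d (B * 'X_[m])) ->
  reduces V d (B * A).
Proof.
move=> HA; rewrite [A]mpolyE mulr_sumr.
have Hm m : m \in msupp A -> reduces V d (B * (A@_m *: 'X_[m])).
  move=> /HA [R RV FR]; exists (A@_m *: R); first exact: form_overZ.
  by rewrite -scalerAr -scalerBr -mul_mpolyC; apply: dvd_formMl.
rewrite big_seq; apply: (big_ind (reduces V d)) => //.
  by apply: reduces_id; split; [apply: dhomog0 | move=> m; rewrite msupp0].
move=> A1 A2 [R RV FR] [R' RV' FR']; exists (R + R'); first exact: form_overD.
by rewrite opprD addrACA; apply: dvd_formD.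
Qed.

Lemma reduces_trans V V' d d' A B :
    reduces V d A -> (forall R, form_over V d R -> reduces V' d' (B * R)) ->
  reduces V' d' (B * A).
Proof.
move=> [R RV FR] HB; have [R' RV' FR'] := HB R RV; exists R' => //.
have ->: B * A - R' = B * (A - R) + (B * R - R') by ring.
by apply: dvd_formD => //; apply: dvd_formMl.
Qed.

(* Reduction modulo [F] eliminates its monomial [X_i X_j^n]. *)
Definition small_exp (m : 'X_{1..3}) : Prop := (m j < n)%N.

(** Replaces [X_i X_j^n] by [- T], the rest of the equation; [T] has degree at most [n - 1] in
    [X_j], since [G] has degree [n - 2]. *)
Lemma reduces_leading (a c : nat) :
  reduces small_exp (a + 1 + n + c) ('X_i ^+ a.+1 * 'X_j ^+ n * 'X_k ^+ c).
Proof.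
have [ij ik jk] := ord3_neq ijk_uniq.
pose T := 'X_j * 'X_k ^+ n + 'X_k * 'X_i ^+ n + 'X_i * 'X_j * 'X_k * G.
exists (- ('X_i ^+ a * 'X_k ^+ c * T)); last first.
  have ->: 'X_i ^+ a.+1 * 'X_j ^+ n * 'X_k ^+ c - - ('X_i ^+ a * 'X_k ^+ c * T)
           = 'X_i ^+ a * 'X_k ^+ c * F.
    by rewrite /F /cyclic_eq /T exprS; ring.
  exact/dvd_formMl/dvd_form_id.
split; first by rewrite /T; solve_homog.
have Di : deg_le j 0 ('X_i : {mpoly K[3]}).
  by have := @deg_leX K j i; rewrite (negPf ij).
have Dk : deg_le j 0 ('X_k : {mpoly K[3]}).
  by have := @deg_leX K j k; rewrite eq_sym (negPf jk).
have Dj : deg_le j 1 ('X_j : {mpoly K[3]}).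
  by have := @deg_leX K j j; rewrite eqxx.
have DG : deg_le j (n - 2) G by apply: deg_le_homog.
have DXn l a' : deg_le j 0 ('X_l : {mpoly K[3]}) ->
    deg_le j 0 ('X_l ^+ a' : {mpoly K[3]}).
  by move=> Dl; have := deg_leXn (a := a') Dl; rewrite mul0n.
have DM b A B : deg_le j 0 A -> deg_le j b B -> deg_le j b (A * B).
  by move=> DA DB; rewrite -[b]add0n; apply: deg_leM.
suff: deg_le j (n - 1) (- ('X_i ^+ a * 'X_k ^+ c * T)).
  by move=> DT m /DT; rewrite /small_exp; lia.
apply: deg_leN; apply: (DM _); first by apply: (DM 0%N); apply: (DXn _).
apply: deg_leD; last first.
  rewrite -2!mulrA; apply: (DM _) => //.
  have ->: (n - 1 = 1 + (n - 2))%N by lia.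
  by apply: deg_leM => //; apply: (DM _).
apply: deg_leD; last by apply: (DM _) => //; apply/deg_leW/DXn.
by rewrite mulrC; apply: (DM _); [apply: (DXn _) | apply: deg_leW Dj; lia].
Qed.

(** Either the exponent of [X_j] stays below [n], or it becomes exactly [n] and the available factor
    [X_i] allows a reduction. *)
Lemma reduces_mulX (m : 'X_{1..3}) : small_exp m -> (0 < m i)%N ->
  reduces small_exp (mdeg m).+1 ('X_j * 'X_[m]).
Proof.
have [ij ik jk] := ord3_neq ijk_uniq.
move=> m_small mi; have [lt_mj|le_mj] := ltnP (m j).+1 n.
  have ->: 'X_j * 'X_[m] = 'X_[U_(j) + m] :> {mpoly K[3]} by rewrite mpolyXD.
  have ->: ((mdeg m).+1 = mdeg (U_(j) + m))%N by rewrite mdegD mdeg1.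
  by apply: reducesX; rewrite /small_exp mnmDE mnm1E eqxx.
have mj : (m j).+1 = n by apply/eqP; rewrite eqn_leq le_mj andbT.
have := reduces_leading (m i).-1 (m k).
rewrite prednK // addn1 prednK // -mj.
have ->: (m i + (m j).+1 + m k = (mdeg m).+1)%N.
  by rewrite (mdeg3 ijk_uniq) addnS addSn.
suff ->: 'X_j * 'X_[m] = 'X_i ^+ m i * 'X_j ^+ (m j).+1 * 'X_k ^+ m k
  :> {mpoly K[3]} by [].
by rewrite [in LHS](mpolyX3 ijk_uniq K m) exprS; ring.
Qed.

(** The monomials not divisible by [X_i X_j^n]. *)
Definition reduced_exp (m : 'X_{1..3}) : Prop := m i = 0%N \/ (m j < n)%N.

(** The factors [X_j] are multiplied in one at a time, with a reduction after each; monomials free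
    of [X_i] stay reduced. *)
Lemma normal_form d A : A \is d.-homog -> reduces reduced_exp d A.
Proof.
have [ij ik jk] := ord3_neq ijk_uniq.
move=> Ad; rewrite -[A]mul1r; apply: reduces_sum => m m_in; rewrite mul1r.
have := dhomogP _ _ _ Ad m m_in; rewrite /= (mdeg3 ijk_uniq) => <-.
rewrite (mpolyX3 ijk_uniq K m) [_ * 'X_j ^+ _]mulrC -mulrA.
elim: (m j) => [|b IHb].
  rewrite addn0 expr0 mul1r.
  have ->: 'X_i ^+ m i * 'X_k ^+ m k = 'X_[U_(i) *+ m i + U_(k) *+ m k]
     :> {mpoly K[3]} by rewrite mpolyXD -!mpolyXn.
  have ->: (m i + m k)%N = mdeg (U_(i) *+ m i + U_(k) *+ m k).
    by rewrite mdegD !mdegMn !mdeg1 !mul1n.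
  apply: reducesX; right; rewrite mnmDE !mulmnE !mnm1E (negPf ij).
  by rewrite eq_sym (negPf jk); lia.
rewrite exprS -mulrA addnS addSn; apply: reduces_trans IHb _ => R [Rd RV].
apply: reduces_sum => u u_in.
have <-: mdeg u = (m i + b + m k)%N by apply: (dhomogP _ _ _ Rd).
have [ui|ui] := posnP (u i).
  have ->: 'X_j * 'X_[u] = 'X_[U_(j) + u] :> {mpoly K[3]} by rewrite mpolyXD.
  have ->: ((mdeg u).+1 = mdeg (U_(j) + u))%N by rewrite mdegD mdeg1.
  by apply: reducesX; left; rewrite mnmDE mnm1E eq_sym (negPf ij).
apply: (@reducesW small_exp); first by move=> v; right.
by apply: reduces_mulX => //; case: (RV u u_in) => //; rewrite /small_exp; lia.
Qed.

(** The factor [X_i^d] pairs every [X_j] with an [X_i], so that [reduces_mulX] applies at each step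
    and no monomial with a high power of [X_j] survives. *)
Lemma small_normal_form d A :
  A \is d.-homog -> reduces small_exp (d + d) ('X_i ^+ d * A).
Proof.
have [ij ik jk] := ord3_neq ijk_uniq.
move=> Ad; apply: reduces_sum => m m_in.
have := dhomogP _ _ _ Ad m m_in; rewrite /= (mdeg3 ijk_uniq) => deg_m.
have le_d : (m j <= d)%N by lia.
have ->: 'X_i ^+ d * 'X_[m] = ('X_j * 'X_i) ^+ m j *
     ('X_i ^+ (d - m j + m i) * 'X_k ^+ m k) :> {mpoly K[3]}.
  rewrite (mpolyX3 ijk_uniq K m) -{1}(subnKC le_d) !exprD exprMn; ring.
have ->: (d + d = m j + m j + ((d - m j + m i) + m k))%N by lia.
move: (d - m j + m i)%N => a; elim: (m j) => [|b IHb].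
  rewrite expr0 mul1r.
  have ->: 'X_i ^+ a * 'X_k ^+ m k = 'X_[U_(i) *+ a + U_(k) *+ m k]
     :> {mpoly K[3]} by rewrite mpolyXD -!mpolyXn.
  have ->: (0 + 0 + (a + m k))%N = mdeg (U_(i) *+ a + U_(k) *+ m k).
    by rewrite mdegD !mdegMn !mdeg1 !mul1n.
  apply: reducesX; rewrite /small_exp mnmDE !mulmnE !mnm1E (negPf ij).
  by rewrite eq_sym (negPf jk); lia.
rewrite exprS -mulrA; apply: reduces_trans IHb _ => R [Rd RV].
apply: reduces_sum => u u_in; rewrite -mulrA.
have ->: 'X_i * 'X_[u] = 'X_[U_(i) + u] :> {mpoly K[3]} by rewrite mpolyXD.
have ->: (b.+1 + b.+1 + (a + m k) = (mdeg (U_(i) + u)).+1)%N.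
  by rewrite mdegD mdeg1; have /= := dhomogP _ _ _ Rd u u_in; lia.
apply: reduces_mulX; last by rewrite mnmDE mnm1E eqxx.
by rewrite /small_exp mnmDE mnm1E (negPf ij); apply: RV.
Qed.

(** The exponents of [X_j] and [X_k] are the remainder and quotient of the order by [n]; the degree
    then gives that of [X_i]. *)
Lemma small_exp_inj d R : form_over small_exp d R ->
  {in msupp R &, injective (fun m : 'X_{1..3} => m j + n * m k)%N}.
Proof.
move=> [Rd RV] m1 m2 m1_in m2_in eq_o.
have deg_m1 := dhomogP _ _ _ Rd m1 m1_in; rewrite /= (mdeg3 ijk_uniq) in deg_m1.
have deg_m2 := dhomogP _ _ _ Rd m2 m2_in; rewrite /= (mdeg3 ijk_uniq) in deg_m2.
have lt1 := RV _ m1_in; have lt2 := RV _ m2_in.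
have ej : m1 j = m2 j.
  have := congr1 (modn^~ n) eq_o => /=.
  by rewrite ![(_ + n * _)%N]addnC ![(n * _)%N]mulnC !modnMDl !modn_small.
have ek : m1 k = m2 k by clear -eq_o ej n_ge3; nia.
by apply: (mnm3P ijk_uniq) => //; clear -deg_m1 deg_m2 ej ek; lia.
Qed.

Lemma small_form_order d R : form_over small_exp d R -> R != 0 ->
  exists o, forall psi, order0 psi n -> order0 (at_branch i j psi R) o.
Proof.
move=> RV R0; have [m _ Hm] := at_branch_order ijk_uniq R0 (small_exp_inj RV).
by exists (m j + n * m k)%N.
Qed.

(** Setting [X_i = 0] turns [F] into [X_j X_k^n], which is nonzero; hence the cofactor of [F] is
    divisible by [X_i]. *)
Lemma dvd_form_mulX A : dvd_form F ('X_i * A) -> dvd_form F A.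
Proof.
have [ij ik jk] := ord3_neq ijk_uniq.
pose h : 'I_3 -> {mpoly K[3]} := fun l => if l == i then 0 else 'X_l.
pose kill := mmap (@mpolyC 3 K) h.
have killX l : kill 'X_l = if l == i then 0 else 'X_l.
  by rewrite /kill mmapX mmap1U.
have kill_dvd B : exists B', B - kill B = 'X_i * B'.
  rewrite {1}[B]mpolyE /kill /mmap -sumrB.
  elim/big_ind: _; first by exists 0; rewrite mulr0.
    by move=> _ _ [B1 ->] [B2 ->]; exists (B1 + B2); rewrite mulrDr.
  move=> m _; rewrite -mul_mpolyC -mulrBr (mmap1_3 ijk_uniq) (mpolyX3 ijk_uniq K m).
  rewrite /h eqxx eq_sym (negPf ij) eq_sym (negPf ik).
  case: (m i) => [|a]; first by exists 0; rewrite !expr0 !mul1r subrr !mulr0.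
  exists ((B@_m)%:MP * ('X_i ^+ a * 'X_j ^+ m j * 'X_k ^+ m k)).
  by rewrite expr0n /= !mul0r subr0 exprS; ring.
move=> [Q XA].
have killM p q : kill (p * q) = kill p * kill q by apply: rmorphM.
have killF : kill F = 'X_j * 'X_k ^+ n.
  rewrite /F /cyclic_eq /kill !rmorphD !rmorphM !rmorphXn /= -!/(kill _) !killX.
  rewrite eqxx eq_sym (negPf ij) eq_sym (negPf ik).
  by rewrite expr0n; case: (n) n_ge3 => //= n' _; ring.
have := congr1 kill XA; rewrite !killM killF killX eqxx mul0r => /esym/eqP.
have X0 l : 'X_l != 0 :> {mpoly K[3]} by rewrite -msupp_eq0 msuppX.
rewrite !mulf_eq0 expf_eq0 !(negPf (X0 _)) andbF !orbF => /eqP kQ.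
have [Q' ] := kill_dvd Q; rewrite kQ subr0 => QE; exists Q'.
by apply: (mulfI (X0 i)); rewrite XA QE mulrA.
Qed.

Lemma dvd_form_mulXn a A : dvd_form F ('X_i ^+ a * A) -> dvd_form F A.
Proof.
elim: a => [|a IHa]; first by rewrite expr0 mul1r.
by rewrite exprS -mulrA => /dvd_form_mulX.
Qed.

(* The remainder of a form not divisible by [F] has finite order along the
   branch, where [F] vanishes to arbitrarily high order. *)
Lemma dvd_form_prime d e A B : A \is d.-homog -> B \is e.-homog ->
  dvd_form F (A * B) -> ~ dvd_form F A -> dvd_form F B.
Proof.
move=> Ad Be [Q AB] nA.
have [R [Rd RV] FR] := small_normal_form Ad.
have [R' [Rd' RV'] FR'] := small_normal_form Be.
have [R0|R0] := eqVneq R 0.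
  by case: nA; apply: (@dvd_form_mulXn d); rewrite -[X in dvd_form F X]subr0 -R0.
have [R'0|R'0] := eqVneq R' 0.
  by apply: (@dvd_form_mulXn e); rewrite -[X in dvd_form F X]subr0 -R'0.
have [o Ho] := small_form_order (conj Rd RV) R0.
have [o' Ho'] := small_form_order (conj Rd' RV') R'0.
(* [R R'] has order [o + o'] along every admissible branch, whereas here [F] vanishes to higher
   order. *)
have [psi opsi Fpsi] := branch_exists n_ge3 G_homog ijk_uniq (o + o').+1.
have FRR' : dvd_form F (R * R').
  have ->: R * R' = 'X_i ^+ d * 'X_i ^+ e * (A * B) -
      ('X_i ^+ d * A * ('X_i ^+ e * B - R') + ('X_i ^+ d * A - R) * R') by ring.
  apply: dvd_formB; first by apply: dvd_formMl; exists Q.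
  by apply: dvd_formD; [apply: dvd_formMl | apply: dvd_formMr].
have [Q' RR'] := FRR'.
have := order0M (Ho psi opsi) (Ho' psi opsi).
rewrite -rmorphM RR' rmorphM /= => oRR'.
have := vanishes_lt (vanishesMl (at_branch i j psi Q') Fpsi) oRR'.
by rewrite ltnn.
Qed.

End NormalForm.

(** * A Nullstellensatz in two variables *)

Section Nullstellensatz.

Variable K : closedFieldType.

(** Euclidean descent: a nonconstant [p] in [J] has a root [y]; reducing modulo [p] an element of
    [J] that is nonzero at [y] leaves a smaller nonzero element. *)
Lemma poly_ideal_unit (J : {poly K} -> Prop) :
    (forall p q, J p -> J q -> J (p + q)) -> (forall p q, J q -> J (p * q)) ->
    (forall y, exists2 p, J p & p.[y] != 0) ->
  J 1.
Proof.
move=> JD JM no_root.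
have J_size N p : J p -> p != 0 -> (size p <= N)%N -> J 1.
  elim: N p => [|N IHN] p Jp p0; first by rewrite leqn0 size_poly_eq0 (negPf p0).
  move=> le_p.
  have [/eqP/size_poly1P[c c0 def_p]|/closed_rootP[y py]] := eqVneq (size p) 1%N.
    by have := JM c^-1%:P p Jp; rewrite def_p -polyCM mulVf.
  have [q Jq qy] := no_root y; apply: (IHN (q %% p)).
  - have ->: q %% p = q + - (q %/ p) * p by rewrite {2}(divp_eq q p); ring.
    by apply: JD => //; apply: JM.
  - apply: contra_neq qy => p_q; apply/rootP; rewrite -dvdp_XsubCl.
    apply: (@dvdp_trans _ p); first by rewrite dvdp_XsubCl.
    by rewrite /dvdp p_q.
  by rewrite -ltnS; apply: leq_trans le_p; rewrite ltn_modp.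
have [p Jp p0] := no_root 0; apply: (J_size (size p) p) => //.
by apply: contraNneq p0 => ->; rewrite horner0.
Qed.

(* The determinant of multiplication by [h] on [K[y][x] / g], which is free
   over [K[y]], lies in the ideal generated by [g] and [h]; it does not
   vanish at [y] if [h] is 1 there. *)
Lemma nullstellensatz (I : {poly {poly K}} -> Prop) (g : {poly {poly K}}) :
    (forall p q, I p -> I q -> I (p + q)) -> (forall p q, I q -> I (p * q)) ->
    g \is monic -> I g ->
    (forall x y, exists2 p, I p & (map_poly (horner_eval y) p).[x] != 0) ->
  I 1.
Proof.
move=> ID IM g_monic Ig no_zero.
suff: I 1%:P by [].
apply: (@poly_ideal_unit (fun c => I c%:P)) => [p q|p q|y].
- by rewrite polyCD; apply: ID.
- by rewrite polyCM; apply: IM.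
(* The ideal restricted to the line of ordinate [y] has no zero, hence contains 1. *)
have [h Ih hy1] : exists2 h, I h & map_poly (horner_eval y) h = 1.
  apply: (@poly_ideal_unit (fun p => exists2 h, I h & map_poly (horner_eval y) h = p)).
  - move=> _ _ [h Ih <-] [h' Ih' <-]; exists (h + h'); first exact: ID.
    by rewrite rmorphD.
  - move=> p _ [h Ih <-]; exists (map_poly polyC p * h); first exact: IM.
    rewrite rmorphM /= -map_poly_comp map_poly_id // => c _ /=.
    by rewrite /horner_eval hornerC.
  - move=> x; have [p Ip px] := no_zero x y.
    by exists (map_poly (horner_eval y) p); first exists p.
have [n size_g] : exists n, size g = n.+1.
  by exists (size g).-1; rewrite prednK // size_poly_gt0 monic_neq0.
pose r a := Pdiv.Ring.rmodp ('X^a * h) g; pose q a := Pdiv.Ring.rdivp ('X^a * h) g.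
have rE a : 'X^a * h = q a * g + r a by apply: Pdiv.RingMonic.rdivp_eq.
have size_r a : (size (r a) <= n)%N.
  by rewrite -ltnS -size_g Pdiv.Ring.ltn_rmodp monic_neq0.
pose M : 'M[{poly K}]_n := \matrix_(a, b) (r a)`_b.
exists (\det M); last first.
  rewrite -[_.[y]]/(horner_eval y (\det M)) -det_map_mx.
  suff ->: map_mx (horner_eval y) M = 1%:M by rewrite det1 oner_neq0.
  apply/matrixP => a b; rewrite !mxE.
  pose g0 := map_poly (horner_eval y) g; pose r0 := map_poly (horner_eval y) (r a).
  have XE : 'X^a = map_poly (horner_eval y) (q a) * g0 + r0.
    rewrite /g0 /r0 -rmorphM -rmorphD -rE rmorphM /= hy1 mulr1.
    by rewrite map_polyXn.
  have g0_monic : g0 \is monic by apply: monic_map.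
  have size_g0 : size g0 = n.+1.
    by rewrite -size_g size_map_poly_id0 // (monicP g_monic) rmorph1 oner_neq0.
  (* At [y], where [h] is 1, [X^a] with [a < n] is its own remainder modulo [g0]; so [M] specializes
     to the identity. *)
  have r0E : r0 = 'X^a.
    have size_r0 : (size r0 <= n)%N by apply: leq_trans (size_r a); apply: size_poly.
    have: (size ('X^a - r0)%R <= n)%N.
      apply: leq_trans (size_polyD _ _) _.
      by rewrite size_polyN geq_max size_polyXn ltn_ord size_r0.
    rewrite XE addrK; have [->|q0] := eqVneq (map_poly (horner_eval y) (q a)) 0.
      by rewrite mul0r add0r.
    rewrite size_Mmonic // size_g0 => le_n; exfalso.
    move: q0 le_n; rewrite -size_poly_gt0.
    by case: (size _) => // s _; rewrite addSn addnS ltnNge leq_addl.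
  by rewrite -coef_map -/r0 r0E coefXn eq_sym.
have [n0|n_gt0] := posnP n.
  have g1 : g = 1.
    have gC : g = (g`_0)%:P by apply: size1_polyC; rewrite size_g n0.
    by have := monicP g_monic; rewrite gC lead_coefC => ->.
  by rewrite -[_%:P]mulr1 -g1; apply: IM.
pose o := Ordinal n_gt0.
pose MP := map_mx (@polyC {poly K}) M.
pose v : 'cV[{poly {poly K}}]_n := \col_b 'X^b.
have Mv a : (MP *m v) a 0 = r a.
  have ->: r a = \poly_(b < n) (r a)`_b.
    apply/polyP => c; rewrite coef_poly; case: ltnP => // le_nc.
    by rewrite nth_default // (leq_trans (size_r a)).
  rewrite mxE poly_def.
  by apply: eq_bigr => b _; rewrite !mxE mul_polyC.
(* Cramer's rule: the entries of [MP *m v] are the [r a], which lie in [I], and the first entry of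
   [v] is 1. *)
have: (\det MP)%:M *m v = \adj MP *m (MP *m v) by rewrite mulmxA mul_adj_mx.
move/matrixP/(_ o 0); rewrite mul_scalar_mx !mxE expr0 mulr1 det_map_mx => ->.
have I0 : I 0 by rewrite -(mul0r g); apply: IM.
apply: (big_ind I) => // b _; rewrite Mv; apply: (IM _).
have ->: r b = 'X^b * h + - q b * g by rewrite rE; ring.
by apply: ID; apply: IM.
Qed.

End Nullstellensatz.

(** * Passage to an affine chart and back *)

Section Dehomogenization.

Variables (K : fieldType) (i j k : 'I_3).
Hypothesis ijk_uniq : uniq [:: i; j; k].

(* The chart [X_k = 1]: [X_i] becomes the outer variable and [X_j] the inner
   one. *)
Definition dehom : {mpoly K[3]} -> {poly {poly K}} :=
  mmap (polyC \o polyC) (coords3 i j 'X 'X%:P 1).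

HB.instance Definition _ :=
  GRing.RMorphism.copy dehom
    (mmap (polyC \o @polyC K) (coords3 i j 'X 'X%:P 1)).

Lemma dehomX :
  (dehom 'X_i = 'X) * (dehom 'X_j = 'X%:P) * (dehom 'X_k = 1).
Proof. by rewrite /dehom !mmapX !mmap1U !(coords3E ijk_uniq). Qed.

Lemma dehomB : {morph dehom : A B / A - B}.
Proof. exact: rmorphB. Qed.

Lemma dehomM : {morph dehom : A B / A * B}.
Proof. exact: rmorphM. Qed.

Lemma dehomXkn a : dehom ('X_k ^+ a) = 1.
Proof. by rewrite rmorphXn /= dehomX expr1n. Qed.

Lemma dehomC c : dehom c%:MP = c%:P%:P.
Proof. by rewrite /dehom mmapC. Qed.

Lemma dehom_monomial (m : 'X_{1..3}) : dehom 'X_[m] = ('X^(m j))%:P * 'X^(m i).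
Proof.
by rewrite (mpolyX3 ijk_uniq K m) !rmorphM !rmorphXn /= !dehomX expr1n mulr1 mulrC.
Qed.

Lemma dehom_sum A :
  dehom A = \sum_(m <- msupp A) (A@_m *: 'X^(m j))%:P * 'X^(m i).
Proof.
rewrite {1}[A]mpolyE rmorph_sum /=; apply: eq_bigr => m _.
by rewrite -mul_mpolyC rmorphM /= dehomC dehom_monomial mulrA -polyCM -mul_polyC.
Qed.

Lemma size_dehom d A : A \is d.-homog -> (size (dehom A) <= d.+1)%N.
Proof.
move=> Ad; rewrite dehom_sum big_seq.
apply: (big_ind (fun p : {poly {poly K}} => (size p <= d.+1)%N)).
- by rewrite size_poly0.
- by move=> p q sp sq; apply: leq_trans (size_polyD _ _) _; rewrite geq_max sp.
move=> m m_in; rewrite mul_polyC; apply: leq_trans (size_scale_leq _ _) _.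
rewrite size_polyXn; have := dhomogP _ _ _ Ad m m_in.
by rewrite /= (mdeg3 ijk_uniq); lia.
Qed.

(** In a fixed degree, the exponents of [X_i] and [X_j] determine that of [X_k], so distinct
    monomials stay distinct. *)
Lemma dehom_inj d A : A \is d.-homog -> dehom A = 0 -> A = 0.
Proof.
move=> Ad A0; apply/eqP; rewrite -msupp_eq0; case E: (msupp A) => [//|m s].
have m_in : m \in msupp A by rewrite E mem_head.
have := m_in; rewrite mcoeff_msupp => /eqP[].
have := congr1 (fun p : {poly {poly K}} => p`_(m i)`_(m j)) A0.
rewrite /= !coef0 dehom_sum coef_sum coef_sum (bigD1_seq m) ?msupp_uniq //=.
rewrite coefCM coefXn eqxx mulr1 coefZ coefXn eqxx mulr1.
rewrite big_seq_cond big1 ?addr0 // => m' /andP[m'_in ne_m].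
rewrite coefCM coefXn; have [ei|] := eqVneq (m i) (m' i); last by rewrite mulr0 coef0.
rewrite mulr1 coefZ coefXn; have [ej|] := eqVneq (m j) (m' j); last by rewrite mulr0.
case/eqP: ne_m; have := dhomogP _ _ _ Ad m m_in; have := dhomogP _ _ _ Ad m' m'_in.
rewrite /= !(mdeg3 ijk_uniq) => deg_m' deg_m.
by apply: (mnm3P ijk_uniq) => //; lia.
Qed.

(** Induction on both variables; summands are brought to a common degree by powers of [X_k]. *)
Lemma homogenize c : exists d C, C \is d.-homog /\ dehom C = c.
Proof.
have hom0 : exists d C, C \is d.-homog /\ dehom C = 0.
  by exists 0%N, 0; rewrite dhomog0 rmorph0.
have homD p q : (exists d C, C \is d.-homog /\ dehom C = p) ->
    (exists d C, C \is d.-homog /\ dehom C = q) ->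
  exists d C, C \is d.-homog /\ dehom C = p + q.
  move=> [d [C [Cd <-]]] [e [D [De <-]]].
  exists (d + e)%N, (C * 'X_k ^+ e + D * 'X_k ^+ d); split; first by solve_homog.
  by rewrite rmorphD !rmorphM !rmorphXn /= !dehomX !expr1n !mulr1.
elim/poly_ind: c => [//|p c [d [C [Cd <-]]]]; apply: (homD _ _).
  by exists d.+1, (C * 'X_i); split; [solve_homog | rewrite rmorphM /= dehomX].
elim/poly_ind: c => [|q c [e [D [De Dq]]]]; first by rewrite polyC0.
rewrite polyCD polyCM; apply: (homD _ _); last first.
  exists 0%N, c%:MP; rewrite dehomC -[c%:MP]alg_mpolyC; split=> //.
  exact/dhomogZ/dhomog1.
by exists e.+1, (D * 'X_j); split; [solve_homog | rewrite rmorphM /= dehomX Dq].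
Qed.

(** Powers of [X_k] equalize the degrees of [A] and of the homogenized product; then [dehom_inj]
    applies. *)
Lemma dvd_form_dehom (F A : {mpoly K[3]}) c d e :
    A \is d.-homog -> F \is e.-homog -> dehom A = c * dehom F ->
  exists a, dvd_form F ('X_k ^+ a * A).
Proof.
move=> Ad Fe AE; have [b [C [Cb Cc]]] := homogenize c.
exists (b + e)%N, ('X_k ^+ d * C).
apply/subr0_eq/(@dehom_inj (b + e + d)); first by solve_homog.
by rewrite dehomB !dehomM !dehomXkn !mul1r Cc AE subrr.
Qed.

Lemma dehom_ev A x y :
  (map_poly (horner_eval y) (dehom A)).[x] = ev A (\row_l coords3 i j x y 1 l).
Proof.
rewrite dehom_sum rmorph_sum horner_sum /ev mevalE; apply: eq_bigr => m _.
rewrite rmorphM /= map_polyC map_polyXn hornerM hornerC hornerXn /=.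
rewrite /horner_eval hornerZ hornerXn (big_ord3 ijk_uniq) /= !mxE.
by rewrite !(coords3E ijk_uniq) expr1n; ring.
Qed.

End Dehomogenization.

Section DehomogenizedCurve.

Variables (K : fieldType) (n : nat) (G : {mpoly K[3]}) (i j k : 'I_3).
Hypothesis n_ge3 : (3 <= n)%N.
Hypothesis G_homog : G \is (n - 2).-homog.
Hypothesis ijk_uniq : uniq [:: i; j; k].

Let F := cyclic_eq n G i j k.

(** The leading term comes from [X_k X_i^n]; the term with [G] has degree at most [n - 1] in
    [X_i]. *)
Lemma dehom_cyclic_monic : dehom i j F \is monic.
Proof.
have ->: dehom i j F =
    'X^n + ('X * ('X^n)%:P + 'X%:P + 'X * 'X%:P * dehom i j G).
  rewrite /F /cyclic_eq !rmorphD !rmorphM !rmorphXn /= !(dehomX _ ijk_uniq).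
  by rewrite expr1n; ring.
rewrite monicE lead_coefDl ?lead_coefXn // size_polyXn ltnS.
have size_X : (size ('X : {poly {poly K}}) = 2)%N by rewrite size_polyX.
have size_MC (p : {poly {poly K}}) c : (size (p * c%:P)%R <= size p)%N.
  by rewrite mulrC mul_polyC size_scale_leq.
apply: leq_trans (size_polyD _ _) _; rewrite geq_max; apply/andP; split.
  apply: leq_trans (size_polyD _ _) _; rewrite geq_max; apply/andP; split.
    by apply: leq_trans (size_MC _ _) _; rewrite size_X ltnW.
  by apply: leq_trans (size_polyC_leq1 _) _; lia.
apply: leq_trans (size_polyMleq _ _) _.
apply: (@leq_trans (2 + (n - 2).+1).-1); last by lia.
rewrite -!subn1 leq_sub2r // leq_add //; last exact: (size_dehom ijk_uniq).
by rewrite -size_X.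
Qed.

(** The extra power of [X_k] cancels by [dvd_form_mulXn], applied to the rotated triple
    [(k, i, j)]. *)
Lemma dehom_dvd d A c : A \is d.-homog -> dehom i j A = c * dehom i j F ->
  dvd_form F A.
Proof.
move=> Ad AE.
have Fh : F \is (n.+1).-homog := cyclic_eq_homog n_ge3 G_homog i j k.
have kij_uniq : uniq [:: k; i; j] by rewrite -(rot_uniq 1).
have [a] := dvd_form_dehom ijk_uniq Ad Fh AE.
rewrite /F -cyclic_eq_rot -cyclic_eq_rot.
exact: (dvd_form_mulXn n_ge3 kij_uniq).
Qed.

End DehomogenizedCurve.

(** * The function field, and the local ring at the centre of the branch *)

Lemma divB_eq (L : fieldType) (a b c d e h : L) : b != 0 -> d != 0 -> h != 0 ->
  a / b - c / d = e / h -> h * (a * d - c * b) = e * (b * d).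
Proof.
move=> b0 d0 h0; rewrite -mulNr addf_div // => /eqP.
rewrite eqr_div ?mulf_neq0 // => /eqP <-; ring.
Qed.

Lemma divB_div (L : fieldType) (a b c d : L) : b != 0 -> d != 0 ->
  a / b - c / d = (a * d - c * b) / (b * d).
Proof. by move=> b0 d0; rewrite -mulNr addf_div // mulNr. Qed.

Section FunctionField.

Variables (K : fieldType) (n : nat) (G : {mpoly K[3]}) (i j k : 'I_3).
Hypothesis n_ge3 : (3 <= n)%N.
Hypothesis G_homog : G \is (n - 2).-homog.
Hypothesis ijk_uniq : uniq [:: i; j; k].

Let F := cyclic_eq n G i j k.
Implicit Types (A B C D : {mpoly K[3]}) (P Q : 'rV[K]_3).

Lemma ndvd_form1 : ~ dvd_form F 1.
Proof.
have [ij ik jk] := ord3_neq ijk_uniq.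
pose P : 'rV[K]_3 := \row_l coords3 i j 1 0 0 l.
have FP : ev F P = 0.
  rewrite /ev /F /cyclic_eq !mevalD !mevalM !rmorphXn /= !mevalXU !mxE.
  rewrite !(coords3E ijk_uniq) expr0n gtn_eqF; last by lia.
  by rewrite /= !(mulr0, mul0r, addr0).
by move=> /(dvd_form_ev FP); rewrite /ev meval1 => /eqP; rewrite oner_eq0.
Qed.

Lemma ndvd_formM d e A B : A \is d.-homog -> B \is e.-homog ->
  ~ dvd_form F A -> ~ dvd_form F B -> ~ dvd_form F (A * B).
Proof. by move=> Ad Be nA nB /(dvd_form_prime n_ge3 G_homog ijk_uniq Ad Be)/(_ nA). Qed.

Lemma ndvd_formXn d A a : A \is d.-homog -> ~ dvd_form F A ->
  ~ dvd_form F (A ^+ a).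
Proof.
move=> Ad nA; elim: a => [|a IHa]; first by rewrite expr0; apply: ndvd_form1.
rewrite exprS; apply: (ndvd_formM (d := d) (e := d * a)) => //.
exact: dhomogMn.
Qed.

Lemma ndvd_form_neq0 A : ~ dvd_form F A -> A != 0.
Proof. by move=> nA; apply/eqP => A0; apply: nA; rewrite A0; apply: dvd_form0. Qed.

Lemma ev_neq0 A P : ev A P != 0 -> A != 0.
Proof. by apply: contraNneq => ->; rewrite /ev meval0. Qed.

Lemma ev_ndvd_form A P : ev F P = 0 -> ev A P != 0 -> ~ dvd_form F A.
Proof. by move=> FP AP /(dvd_form_ev FP)/eqP; apply/negP. Qed.

(** If the difference is [E / H], then [H (A D - C B) = E B D]; [F] divides [E] and is prime, so [H]
    cancels. *)
Lemma ratfun_eq_dvd d e A B C D :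
    A \is d.-homog -> B \is d.-homog -> C \is e.-homog -> D \is e.-homog ->
    B != 0 -> D != 0 -> ratfun_eq F (A%:F / B%:F) (C%:F / D%:F) ->
  dvd_form F (A * D - C * B).
Proof.
move=> Ad Bd Ce De B0 D0 [E [H [[[c Ec Hc] EH] nH [E' FE]]]].
apply: (dvd_form_prime n_ge3 G_homog ijk_uniq Hc _ _ nH (e := d + e)).
  by solve_homog.
have H0 := ndvd_form_neq0 nH; exists (E' * (B * D)).
have nz M : M != 0 -> M%:F != 0 :> {fraction {mpoly K[3]}}.
  by rewrite tofrac_eq0.
have := divB_eq (nz _ B0) (nz _ D0) (nz _ H0) EH.
rewrite -!tofracM -tofracB -!tofracM => /eqP; rewrite tofrac_eq => /eqP->.
by rewrite -/F FE; ring.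
Qed.

Lemma dvd_ratfun_eq d e A B C D :
    A \is d.-homog -> B \is d.-homog -> C \is e.-homog -> D \is e.-homog ->
    ~ dvd_form F B -> ~ dvd_form F D -> dvd_form F (A * D - C * B) ->
  ratfun_eq F (A%:F / B%:F) (C%:F / D%:F).
Proof.
move=> Ad Bd Ce De nB nD FE; exists (A * D - C * B), (B * D); split=> //.
  split; first by exists (d + e)%N; solve_homog.
  have nz M : ~ dvd_form F M -> M%:F != 0 :> {fraction {mpoly K[3]}}.
    by move=> /ndvd_form_neq0; rewrite tofrac_eq0.
  by rewrite (divB_div _ _ (nz _ nB) (nz _ nD)) -!tofracM -tofracB.
exact: ndvd_formM Bd De nB nD.
Qed.

(** Transitivity of equality of fractions in cross-multiplied form; primality cancels [B]. *)
Lemma dvd_form_cross d e c A B C D C' D' : A \is d.-homog -> B \is d.-homog ->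
    C \is e.-homog -> D \is e.-homog -> C' \is c.-homog -> D' \is c.-homog ->
    ~ dvd_form F B -> dvd_form F (A * D - C * B) ->
  dvd_form F (A * D' - C' * B) -> dvd_form F (C * D' - C' * D).
Proof.
move=> Ad Bd Ce De Cc' Dc' nB F1 F2.
apply: (dvd_form_prime n_ge3 G_homog ijk_uniq Bd _ _ nB (e := e + c)).
  by solve_homog.
have ->: B * (C * D' - C' * D) =
    D * (A * D' - C' * B) - D' * (A * D - C * B) by ring.
by apply: dvd_formB; apply: dvd_formMl.
Qed.

Lemma regular_at_dvd Q d A B : A \is d.-homog -> B \is d.-homog ->
    ~ dvd_form F B -> regular_at F Q (A%:F / B%:F) ->
  exists e C D, [/\ C \is e.-homog, D \is e.-homog, ev D Q != 0 &
                    dvd_form F (A * D - C * B)].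
Proof.
move=> Ad Bd nB [g [C [D [[[e Ce De] ->] DQ]]] fg].
exists e, C, D; split=> //; apply: ratfun_eq_dvd Ad Bd Ce De _ _ fg.
  exact: ndvd_form_neq0.
exact: ev_neq0 DQ.
Qed.

Lemma local_regular_at Q f : local_ring Q f -> regular_at F Q f.
Proof.
move=> loc; exists f => //; exists 0, 1; split; last exact: dvd_form0.
  split; first by exists 0%N; [apply: dhomog0 | apply: dhomog1].
  by rewrite subrr tofrac0 mul0r.
exact: ndvd_form1.
Qed.

Section AtCentre.

Variable P : 'rV[K]_3.
Hypotheses (Pi : P 0 i != 0) (Pj : P 0 j = 0) (Pk : P 0 k = 0).

Lemma ev_cyclic_eq_centre : ev F P = 0.
Proof.
rewrite /ev /F /cyclic_eq !mevalD !mevalM !rmorphXn /= !mevalXU Pj Pk.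
by rewrite expr0n gtn_eqF ?(ltn_trans _ n_ge3) //= !(mulr0, mul0r, addr0).
Qed.

Lemma at_branch_dvd N psi A :
  vanishes N (at_branch i j psi F) -> dvd_form F A ->
  vanishes N (at_branch i j psi A).
Proof. by move=> FN [Q ->]; rewrite rmorphM /=; apply: vanishesMl. Qed.

(* [Z * branch_unit = F - X Y^n], and [branch_unit] is a unit at
   [(1 : 0 : 0)]: it exhibits [Z] as a multiple of [Y^n] in the local ring. *)
Definition branch_unit : {mpoly K[3]} :=
  'X_i ^+ n + 'X_j * 'X_k ^+ n.-1 + 'X_i * 'X_j * G.

Lemma branch_unit_homog : branch_unit \is n.-homog.
Proof. by rewrite /branch_unit; solve_homog. Qed.

Lemma branch_unitE : 'X_k * branch_unit - - ('X_i * 'X_j ^+ n) = F.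
Proof.
have XnE (l : 'I_3) : 'X_l ^+ n = 'X_l * 'X_l ^+ n.-1 :> {mpoly K[3]}.
  by rewrite -exprS prednK // (ltn_trans _ n_ge3).
by rewrite /F /cyclic_eq /branch_unit (XnE k); ring.
Qed.

Lemma ev_branch_unit : ev branch_unit P != 0.
Proof.
rewrite /ev /branch_unit !mevalD !mevalM !rmorphXn /= !mevalXU Pj.
by rewrite !(mulr0, mul0r, addr0) expf_neq0.
Qed.

(** Vanishing at [P] excludes the pure power of [X_i]; every other monomial contains [X_j] or
    [X_k]. *)
Lemma form_at_centre d A : A \is d.+1.-homog -> ev A P = 0 ->
  exists A1 A2, [/\ A1 \is d.-homog, A2 \is d.-homog &
                    A = 'X_j * A1 + 'X_k * A2].
Proof.
move=> Ad AP; pose good B := exists A1 A2, [/\ A1 \is d.-homog, A2 \is d.-homog &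
                                 B = 'X_j * A1 + 'X_k * A2].
have good0 : good 0.
  by exists 0, 0; rewrite !mulr0 addr0; split=> //; apply: dhomog0.
have goodD B C : good B -> good C -> good (B + C).
  move=> [B1 [B2 [h1 h2 ->]]] [C1 [C2 [h3 h4 ->]]].
  exists (B1 + C1), (B2 + C2); split; rewrite ?dhomogD // !mulrDr.
  by rewrite addrACA.
have goodZ c B : good B -> good (c *: B).
  move=> [B1 [B2 [h1 h2 ->]]]; exists (c *: B1), (c *: B2).
  by split; rewrite ?dhomogZ // -!scalerAr scalerDr.
have good_mon (m : 'X_{1..3}) : mdeg m = d.+1 -> (0 < m j + m k)%N -> good 'X_[m].
  have sub_mon l : mdeg m = d.+1 -> (0 < m l)%N ->
      'X_[m - U_(l)] \is [in K[3], d.-homog] /\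
      'X_[m] = 'X_l * 'X_[m - U_(l)] :> {mpoly K[3]}.
    move=> deg_m ml; have mE : m = (U_(l) + (m - U_(l)))%MM.
      by rewrite addmC submK // lep1mP -lt0n.
    split; last by rewrite -mpolyXD -mE.
    by rewrite dhomogX /= -(eqn_add2l 1) -[X in (X + _)%N](mdeg1 l) -mdegD -mE deg_m.
  move=> deg_m; rewrite addn_gt0 => /orP[/(sub_mon _ deg_m)|/(sub_mon _ deg_m)] [h mE].
    by exists 'X_[m - U_(j)], 0; rewrite mulr0 addr0; split; rewrite ?dhomog0.
  by exists 0, 'X_[m - U_(k)]; rewrite mulr0 add0r; split; rewrite ?dhomog0.
suff good_supp m : m \in msupp A -> (0 < m j + m k)%N.
  rewrite -/(good A) [A]mpolyE big_seq; apply: (big_ind good) => // m m_in.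
  by apply/goodZ/good_mon; [apply: (dhomogP _ _ _ Ad) | apply: good_supp].
move=> m_in; rewrite lt0n; apply/eqP => m0.
have deg_m := dhomogP _ _ _ Ad m m_in; rewrite /= (mdeg3 ijk_uniq) in deg_m.
have := m_in; rewrite mcoeff_msupp => /eqP[]; apply/eqP.
move/eqP: AP; rewrite /ev mevalE (bigD1_seq m) ?msupp_uniq //=.
rewrite [X in _ + X]big1_seq => [|m' /andP[ne_m m'_in]]; last first.
  have deg_m' := dhomogP _ _ _ Ad m' m'_in; rewrite /= (mdeg3 ijk_uniq) in deg_m'.
  rewrite (big_ord3 ijk_uniq) /= Pj Pk.
  have [mj|mj] := posnP (m' j); last by rewrite expr0n gtn_eqF //= mulr0 mul0r mulr0.
  have [mk|mk] := posnP (m' k).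
    have mi : m' i = m i by clear -deg_m deg_m' m0 mj mk; lia.
    case/eqP: ne_m; apply: (mnm3P ijk_uniq) => //; rewrite ?mj ?mk.
      by clear -m0; lia.
    by clear -m0; lia.
  by rewrite (expr0n _ (m' k)) gtn_eqF //= !mulr0.
have [mj mk] : m j = 0%N /\ m k = 0%N by clear -m0; lia.
rewrite addr0 (big_ord3 ijk_uniq) /= mj mk !expr0 !mulr1 mulf_eq0 expf_eq0.
by rewrite (negPf Pi) andbF orbF.
Qed.

(** The maximal ideal is generated by [X_j / X_i] and [X_k / X_i], and [branch_unitE] makes the
    latter a multiple of the former. *)
Lemma uniformizer_centre : uniformizer F P (('X_j)%:F / ('X_i)%:F).
Proof.
have FP := ev_cyclic_eq_centre.
have XiP : ev 'X_i P != 0 by rewrite /ev mevalXU.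
have nXi := ev_ndvd_form FP XiP.
have nU := ev_ndvd_form FP ev_branch_unit.
split.
  exists 'X_j, 'X_i; split=> //; last by rewrite /ev mevalXU.
  by split=> //; exists 1%N; apply: dhomogXU.
move=> g [A [B [[[d Ad Bd] ->] BP AP]]].
have nB := ev_ndvd_form FP BP.
have Uh := branch_unit_homog.
have AXd : A * 'X_i \is d.+1.-homog by rewrite -(addn1 d); solve_homog.
have AXP : ev (A * 'X_i) P = 0 by rewrite /ev mevalM -/(ev A P) AP mul0r.
have [A1 [A2 [h1 h2 AE]]] := form_at_centre AXd AXP.
(* Multiply [A X_i = X_j A1 + X_k A2] by [branch_unit], replace [X_k branch_unit] by [- X_i X_j^n],
   and divide by [X_j]. *)
pose N := A1 * branch_unit - 'X_i * 'X_j ^+ n.-1 * A2.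
have Nh : N \is (d + n).-homog by rewrite /N; solve_homog.
exists (N%:F / (B * branch_unit)%:F).
  exists N, (B * branch_unit); split.
    by split=> //; exists (d + n)%N => //; solve_homog.
  by rewrite /ev mevalM mulf_neq0 ?ev_branch_unit.
rewrite mulf_div -!tofracM.
apply: (dvd_ratfun_eq (d := d) (e := (d + n).+1)) => //.
- by rewrite -(add1n (d + n)); solve_homog.
- by rewrite -(add1n (d + n)); solve_homog.
- apply: (ndvd_formM (d := 1) (e := d + n)) => //; first exact: dhomogXU.
    by solve_homog.
  exact: ndvd_formM Bd Uh nB nU.
have ->: A * ('X_i * (B * branch_unit)) - 'X_j * N * B = B * A2 * F.
  have XnE : 'X_j ^+ n = 'X_j * 'X_j ^+ n.-1 :> {mpoly K[3]}.
    by rewrite -exprS prednK // (ltn_trans _ n_ge3).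
  have ->: A * ('X_i * (B * branch_unit)) = (A * 'X_i) * B * branch_unit by ring.
  by rewrite -branch_unitE AE /N XnE; ring.
exact/dvd_formMl/dvd_form_id.
Qed.

(** [has_order] allows any uniformizer. Its numerator has order at least 1, as it vanishes at [P],
    and at most 1, as [X_j / X_i] is a multiple of [t]; precision 2 detects this. *)
Lemma at_branch_uniformizer t : uniformizer F P t ->
  exists d T T', [/\ T \is d.-homog, T' \is d.-homog, t = T%:F / T'%:F,
    ev T' P != 0 & forall psi, order0 psi n -> vanishes 2 (at_branch i j psi F) ->
      order0 (at_branch i j psi T) 1].
Proof.
move=> [[T [T' [[[d Td Td'] ->] TP' TP]]] gen].
exists d, T, T'; split=> // psi opsi Fpsi.
have T1 := at_branch_vanish n_ge3 ijk_uniq Td opsi Pi Pj Pk TP.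
split=> //.
have [|h [A [B [[[e Ae Be] ->] BP]]]] := gen (('X_j)%:F / ('X_i)%:F).
  exists 'X_j, 'X_i; split; rewrite ?/ev ?mevalXU //.
  by split=> //; exists 1%N; apply: dhomogXU.
rewrite mulf_div -!tofracM => eq_th.
have X0 l : 'X_l != 0 :> {mpoly K[3]} by rewrite -msupp_eq0 msuppX.
have FXT : dvd_form F ('X_j * (T' * B) - T * A * 'X_i).
  apply: (@ratfun_eq_dvd 1 (d + e)) eq_th; rewrite ?dhomogXU ?dhomogM //.
  by rewrite mulf_neq0 ?(ev_neq0 TP') ?(ev_neq0 BP).
have := at_branch_dvd Fpsi FXT.
rewrite rmorphB !rmorphM /= !(at_branchX ijk_uniq) mulr1 => cong.
have oT' := at_branch_unit n_ge3 ijk_uniq Td' opsi Pj Pk TP'.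
have oB := at_branch_unit n_ge3 ijk_uniq Be opsi Pj Pk BP.
have := order0_cong (order0M (order0X K) (order0M oT' oB)) cong (ltnSn 1).
move=> [TA1 _]; apply: contra_neq TA1 => T10; apply: (@vanishesMr _ 2) => //.
by case=> [|[|]] // _; apply: T1.
Qed.

End AtCentre.

End FunctionField.

(** * Poles of the monomial functions *)

Lemma dvd_form_subXX (K : fieldType) (F A B : {mpoly K[3]}) a :
  dvd_form F (A - B) -> dvd_form F (A ^+ a - B ^+ a).
Proof. by move=> FAB; rewrite subrXX; apply: dvd_formMr. Qed.

Lemma frac_expN (R : idomainType) (A B : R) m :
  (A%:F / B%:F) ^ (- m%:Z) = (B ^+ m)%:F / (A ^+ m)%:F.
Proof. by rewrite -exprnN expr_div_n invf_div !tofracXn. Qed.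

Section Poles.

Variables (K : fieldType) (n : nat) (G : {mpoly K[3]}) (i j k : 'I_3).
Hypothesis n_ge3 : (3 <= n)%N.
Hypothesis G_homog : G \is (n - 2).-homog.
Hypothesis ijk_uniq : uniq [:: i; j; k].

Let F := cyclic_eq n G i j k.
Implicit Types (A B C D : {mpoly K[3]}) (P Q : 'rV[K]_3).

Lemma row3_eq0 Q : Q 0 i = 0 -> Q 0 j = 0 -> Q 0 k = 0 -> Q = 0.
Proof.
move=> Qi Qj Qk; apply/rowP => l; rewrite mxE.
by case: (ord3E ijk_uniq l) => ->.
Qed.

Lemma same_pointE P Q : P 0 i != 0 -> P 0 j = 0 -> P 0 k = 0 -> Q != 0 ->
  (P == Q)%MS = (Q 0 j == 0) && (Q 0 k == 0).
Proof.
move=> Pi Pj Pk Q0; apply/andP/andP => [[_ /sub_rVP[c ->]]|[/eqP Qj /eqP Qk]].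
  by rewrite !mxE Pj Pk mulr0 eqxx.
have Qi : Q 0 i != 0 by apply: contra_neq Q0 => Qi; apply: row3_eq0.
have line c P1 P2 : P1 0 j = 0 -> P1 0 k = 0 -> P2 0 j = 0 -> P2 0 k = 0 ->
    P1 0 i = c * P2 0 i -> (P1 <= P2)%MS.
  move=> hj hk hj' hk' hi; apply/sub_rVP; exists c; apply/rowP => l.
  rewrite !mxE; case: (ord3E ijk_uniq l) => -> //.
    by rewrite hj hj' mulr0.
  by rewrite hk hk' mulr0.
split; first by apply: (line (P 0 i / Q 0 i)); rewrite // divfK.
by apply: (line (Q 0 i / P 0 i)); rewrite // divfK.
Qed.

(** So the line [X_k = 0] meets the curve only at two coordinate points, the possible poles of
    quotients by powers of [X_k]. *)
Lemma ev_cyclic_eq Q : Q 0 k = 0 -> ev F Q = Q 0 i * Q 0 j ^+ n.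
Proof.
move=> Qk; rewrite /ev /F /cyclic_eq !mevalD !mevalM !rmorphXn /= !mevalXU Qk.
by rewrite expr0n gtn_eqF ?(ltn_trans _ n_ge3) //= !(mulr0, mul0r, addr0).
Qed.

(** Each variable is nonzero at one of the coordinate points, all of which lie on the curve. *)
Lemma ndvd_formXU l : ~ dvd_form F 'X_l.
Proof.
have pole i' j' k' : uniq [:: i'; j'; k'] -> cyclic_eq n G i' j' k' = F ->
    ~ dvd_form F 'X_i'.
  move=> u FE; pose P : 'rV[K]_3 := \row_l coords3 i' j' 1 0 0 l.
  have [Pi Pj Pk] : [/\ P 0 i' = 1, P 0 j' = 0 & P 0 k' = 0].
    by rewrite !mxE !(coords3E u).
  apply: (@ev_ndvd_form _ n G i j k _ P).
    by rewrite -/F -FE; exact: (ev_cyclic_eq_centre G i' n_ge3 Pj Pk).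
  by rewrite /ev mevalXU Pi oner_neq0.
case: (ord3E ijk_uniq l) => ->; first exact: pole ijk_uniq _.
  apply: (pole j k i); last exact: cyclic_eq_rot.
  by rewrite -(rot_uniq 2).
apply: (pole k i j); last by rewrite 2!cyclic_eq_rot.
by rewrite -(rot_uniq 1).
Qed.

Section AtPoint.

Variable P : 'rV[K]_3.
Hypotheses (Pi : P 0 i != 0) (Pj : P 0 j = 0) (Pk : P 0 k = 0).

(** On the curve, [X_k = - X_i X_j^n / U]; substituting this in the denominator leaves the exponent
    [b - n (a + b) = - m] of [X_j]. *)
Lemma monomial_order Q a b m : m = (n * a + (n - 1) * b)%N ->
    Q 0 i != 0 -> Q 0 j = 0 -> Q 0 k = 0 ->
  has_order F Q (('X_i ^+ a * 'X_j ^+ b)%:F / ('X_k ^+ (a + b))%:F) (- m%:Z).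
Proof.
move=> def_m Qi Qj Qk; pose U := branch_unit n G i j k.
have Uh : U \is n.-homog by apply: branch_unit_homog.
have UQ : ev U Q != 0 by apply: ev_branch_unit.
have deg : (b + m = n * (a + b))%N by rewrite def_m; clear -n_ge3; nia.
have deg' : (b + m = (a + b) * n)%N by rewrite mulnC.
exists (('X_j)%:F / ('X_i)%:F), (((-U) ^+ (a + b))%:F / ('X_i ^+ (b + m))%:F); split.
- exact: (uniformizer_centre n_ge3 G_homog ijk_uniq).
- exists ((- U) ^+ (a + b)), ('X_i ^+ (b + m)); split.
  + by split=> //; exists (b + m)%N; solve_homog.
  + by rewrite /ev rmorphXn /= mevalXU expf_neq0.
  + by rewrite /ev rmorphXn rmorphN /= expf_neq0 // oppr_eq0.
rewrite frac_expN mulf_div -!tofracM.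
have nX l a' : ~ dvd_form F ('X_l ^+ a').
  by apply: (ndvd_formXn n_ge3 G_homog ijk_uniq (dhomogXU _ l)); apply: ndvd_formXU.
apply: (dvd_ratfun_eq n_ge3 G_homog ijk_uniq (d := a + b) (e := b + m + m)).
- by solve_homog.
- by solve_homog.
- by solve_homog.
- by solve_homog.
- exact: nX.
- by apply: (ndvd_formM n_ge3 G_homog ijk_uniq (d := b + m) (e := m)) => //; solve_homog.
have ->: 'X_i ^+ a * 'X_j ^+ b * ('X_i ^+ (b + m) * 'X_j ^+ m) -
    (- U) ^+ (a + b) * 'X_i ^+ m * 'X_k ^+ (a + b) =
    'X_i ^+ m * (('X_i * 'X_j ^+ n) ^+ (a + b) - (- ('X_k * U)) ^+ (a + b)).
  have ->: (- ('X_k * U)) ^+ (a + b) = 'X_k ^+ (a + b) * (- U) ^+ (a + b).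
    by rewrite -mulrN exprMn.
  by rewrite [in RHS]exprMn -exprM -deg !exprD; ring.
apply/dvd_formMl/dvd_form_subXX.
rewrite opprK addrC -[X in _ + X]opprK (branch_unitE G i j k n_ge3).
exact: dvd_form_id.
Qed.

Lemma monomial_pole_semigroup m :
  monomial_pole n m -> weierstrass_semigroup F P m.
Proof.
move=> [a [b [le_b def_m]]].
have nX l a' : ~ dvd_form F ('X_l ^+ a').
  by apply: (ndvd_formXn n_ge3 G_homog ijk_uniq (dhomogXU _ l)); apply: ndvd_formXU.
exists (('X_i ^+ a * 'X_j ^+ b)%:F / ('X_k ^+ (a + b))%:F).
  exists ('X_i ^+ a * 'X_j ^+ b), ('X_k ^+ (a + b)); split=> //.
  by split=> //; exists (a + b)%N; solve_homog.
move=> Q [Q0 FQ]; rewrite /pole_mult /mult_point same_pointE //.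
have [Qk|Qk] := eqVneq (Q 0 k) 0; last first.
  rewrite andbF; left; split=> //; apply: local_regular_at => //.
  exists ('X_i ^+ a * 'X_j ^+ b), ('X_k ^+ (a + b)); split.
    by split=> //; exists (a + b)%N; solve_homog.
  by rewrite /ev rmorphXn /= mevalXU expf_neq0.
move: FQ; rewrite ev_cyclic_eq // => /eqP.
rewrite mulf_eq0 expf_eq0 (ltn_trans _ n_ge3) //= andbT.
have [Qj _|Qj] := eqVneq (Q 0 j) 0.
  have [m0|m_gt0] := posnP m.
    left; split=> //; apply: local_regular_at => //.
    have [-> ->] : a = 0%N /\ b = 0%N by clear -m0 def_m n_ge3; nia.
    exists 1, 1; split; last by rewrite /ev meval1 oner_neq0.
    split; first by exists 0%N; apply: dhomog1.
    by rewrite !expr0 mulr1.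
  right; split=> //; apply: monomial_order => //.
  by apply: contra_neq Q0 => Qi; apply: row3_eq0.
rewrite orbF => /eqP Qi; left; split=> //.
have jki_uniq : uniq [:: j; k; i] by rewrite -(rot_uniq 2).
pose U := branch_unit n G j k i.
have Uh : U \is n.-homog by apply: branch_unit_homog.
have UQ : ev U Q != 0 by apply: ev_branch_unit.
(* At [(0 : 1 : 0)], [X_i = - X_j X_k^n / U] gives the function order [c = n a - (a + b)], which is
   nonnegative because [b <= (n - 1) a]. *)
have [c def_c] : exists c, (n * a = a + b + c)%N.
  by exists (n * a - (a + b))%N; rewrite subnKC //; clear -le_b n_ge3; nia.
exists (((- 'X_j) ^+ a * 'X_j ^+ b * 'X_k ^+ c)%:F / (U ^+ a)%:F).
  exists ((- 'X_j) ^+ a * 'X_j ^+ b * 'X_k ^+ c), (U ^+ a); split.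
    by split=> //; exists (n * a)%N; solve_homog.
  by rewrite /ev rmorphXn /= expf_neq0.
apply: (dvd_ratfun_eq n_ge3 G_homog ijk_uniq (d := a + b) (e := n * a)).
- by solve_homog.
- by solve_homog.
- by solve_homog.
- by solve_homog.
- exact: nX.
- apply: (ndvd_formXn n_ge3 G_homog ijk_uniq Uh).
  apply: (@ev_ndvd_form _ n G i j k _ Q) => //.
  by rewrite -/F ev_cyclic_eq // Qi mul0r.
have ->: 'X_i ^+ a * 'X_j ^+ b * U ^+ a -
      (- 'X_j) ^+ a * 'X_j ^+ b * 'X_k ^+ c * 'X_k ^+ (a + b) =
    'X_j ^+ b * (('X_i * U) ^+ a - (- ('X_j * 'X_k ^+ n)) ^+ a).
  have ->: (- ('X_j * 'X_k ^+ n)) ^+ a = (- 'X_j) ^+ a * 'X_k ^+ (n * a) :> {mpoly K[3]}.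
    by rewrite -mulNr exprMn -exprM.
  by rewrite [in RHS]exprMn def_c !exprD; ring.
apply/dvd_formMl/dvd_form_subXX.
by rewrite (branch_unitE G j k i n_ge3) (cyclic_eq_rot n G i j k); apply: dvd_form_id.
Qed.

End AtPoint.

End Poles.

(** * Poles of arbitrary functions regular away from the centre *)

Lemma vanishes_or_order0 (K : fieldType) (p : {poly K}) N :
  vanishes N p \/ exists2 m, (m < N)%N & order0 p m.
Proof.
elim: N => [|N [p0|[m lt_m om]]]; first by left.
  have [pN|pN] := eqVneq p`_N 0; last by right; exists N.
  by left=> l; rewrite ltnS leq_eqVlt => /predU1P[->|/p0].
by right; exists m; rewrite // ltnW.
Qed.

Lemma vanishes_unitr (K : fieldType) (p q : {poly K}) N :
  order0 q 0 -> vanishes N (p * q) -> vanishes N p.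
Proof.
move=> oq pq; have [//|[m lt_m om]] := vanishes_or_order0 p N.
by have := vanishes_lt pq (order0M om oq); rewrite addn0 leqNgt lt_m.
Qed.

Section PolesAtCentre.

Variables (K : closedFieldType) (n : nat) (G : {mpoly K[3]}) (i j k : 'I_3).
Hypothesis n_ge3 : (3 <= n)%N.
Hypothesis G_homog : G \is (n - 2).-homog.
Hypothesis ijk_uniq : uniq [:: i; j; k].

Let F := cyclic_eq n G i j k.
Implicit Types (A B C D R : {mpoly K[3]}) (P Q : 'rV[K]_3).

Lemma regular_affine d A B : A \is d.-homog -> B \is d.-homog ->
    ~ dvd_form F B ->
    (forall Q, on_curve F Q -> Q 0 k != 0 -> regular_at F Q (A%:F / B%:F)) ->
  exists e C, C \is e.-homog /\ dvd_form F (A * 'X_k ^+ e - C * B).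
Proof.
move=> Ad Bd nB reg.
(* The ideal of denominators of [A / B] in the coordinate ring of the chart, lifted to polynomials
   in two variables. *)
pose I b := exists c q,
  dehom i j A * b - c * dehom i j B = q * dehom i j F.
have [c [q E]] : I 1; last first.
  have [e [C [Ce Cc]]] := homogenize ijk_uniq c.
  exists e, C; split=> //.
  apply: (dehom_dvd n_ge3 G_homog ijk_uniq (d := d + e) (c := q)).
    by solve_homog.
  have dehomAC : dehom i j (A * 'X_k ^+ e - C * B) =
      dehom i j A * 1 - c * dehom i j B.
    by rewrite dehomB !dehomM (dehomXkn _ ijk_uniq) Cc.
  by rewrite dehomAC E.
apply: (nullstellensatz (g := dehom i j F)).
- move=> p q [c [r E]] [c' [r' E']]; exists (c + c'), (r + r').
  by rewrite !mulrDl -E -E' mulrDr; ring.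
- move=> p q [c [r E]]; exists (p * c), (p * r).
  by rewrite -[RHS]mulrA -E; ring.
- exact: dehom_cyclic_monic.
- by exists 0, (dehom i j A); rewrite mul0r subr0.
move=> x y; pose Q : 'rV[K]_3 := \row_l coords3 i j x y 1 l.
(* Away from the curve, the equation itself is an element of [I] that does not vanish. *)
have [FQ|FQ] := eqVneq (ev F Q) 0; last first.
  exists (dehom i j F); last by rewrite (dehom_ev ijk_uniq).
  by exists 0, (dehom i j A); rewrite mul0r subr0.
have Qk : Q 0 k = 1 by rewrite mxE (coords3E ijk_uniq).
have Q0 : Q != 0.
  by apply/eqP => Q0; move: Qk; rewrite Q0 mxE => /esym/eqP; rewrite oner_eq0.
have [|e [C [D [Ce De DQ [M ADCB]]]]] :=
  regular_at_dvd n_ge3 G_homog ijk_uniq Ad Bd nB (reg Q (conj Q0 FQ) _).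
  by rewrite Qk oner_neq0.
exists (dehom i j D); last by rewrite (dehom_ev ijk_uniq).
exists (dehom i j C), (dehom i j M).
by rewrite -!dehomM -ADCB dehomB.
Qed.

(* Among the reduced monomials, only the [Y^b Z^(e - b)] have order less than
   [e] at [(0 : 1 : 0)], and these orders are distinct. *)
Lemma regular_reduced_form e c R C D Q : form_over (reduced_exp n i j) e R ->
    C \is c.-homog -> D \is c.-homog ->
    Q 0 i = 0 -> Q 0 k = 0 -> ev D Q != 0 ->
    dvd_form F (R * D - C * 'X_k ^+ e) ->
  forall m, m \in msupp R -> m i = 0%N -> m j = 0%N.
Proof.
move=> [Re RV] Cc Dc Qi Qk DQ FR m m_in mi.
have jki_uniq : uniq [:: j; k; i] by rewrite -(rot_uniq 2).
have [psi opsi Fpsi] := branch_exists n_ge3 G_homog jki_uniq e.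
rewrite cyclic_eq_rot in Fpsi.
have oD := at_branch_unit n_ge3 jki_uniq Dc opsi Qk Qi DQ.
(* Along the branch at [Q], [X_k] is the parameter and [D] a unit, so [R] inherits the order [e] of
   [X_k^e]. *)
have R0 : vanishes e (at_branch j k psi R).
  apply: vanishes_unitr oD _; case: FR => M FR.
  have ->: at_branch j k psi R * at_branch j k psi D =
      at_branch j k psi C * 'X^e + at_branch j k psi M * at_branch j k psi F.
    rewrite -!rmorphM -FR rmorphB !rmorphM rmorphXn /= (at_branchX jki_uniq).
    by ring.
  by apply: vanishesD; apply: vanishesMl => //; apply: vanishesXn.
apply/eqP; apply: contraT; rewrite -lt0n => mj.
have deg_m := dhomogP _ _ _ Re m m_in; rewrite /= (mdeg3 ijk_uniq) in deg_m.
have lt_mk : (m k < e)%N by clear -deg_m mj; lia.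
have := m_in; rewrite mcoeff_msupp => /eqP[].
rewrite -(R0 _ lt_mk) at_branch_sum coef_sum (bigD1_seq m) ?msupp_uniq //=.
(* Monomials with a factor [X_i] have order [e + (n - 1) m'_i - m'_j >= e]; those without it are
   other powers of the parameter. *)
rewrite big1_seq ?addr0 => [|m' /andP[ne_m m'_in]]; last first.
  have deg_m' := dhomogP _ _ _ Re m' m'_in; rewrite /= (mdeg3 ijk_uniq) in deg_m'.
  rewrite coefZ; have [m'i|m'i] := posnP (m' i).
    rewrite (mpolyX3 jki_uniq K m') !rmorphM !rmorphXn /= !(at_branchX jki_uniq).
    rewrite m'i expr1n mul1r expr0 mulr1 coefXn.
    have [ek|] := eqVneq (m k) (m' k); last by rewrite mulr0.
    case/eqP: ne_m; apply: (mnm3P ijk_uniq) => //; first by rewrite mi m'i.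
    by clear -ek mi m'i deg_m deg_m'; lia.
  have [_ ->] := at_branch_monomial jki_uniq m' opsi; first by rewrite mulr0.
  have lt_m'j : (m' j < n)%N by case: (RV m' m'_in) => // m'0; rewrite m'0 in m'i.
  by clear -lt_m'j m'i deg_m' lt_mk n_ge3; nia.
rewrite coefZ (mpolyX3 jki_uniq K m) !rmorphM !rmorphXn /= !(at_branchX jki_uniq).
by rewrite mi expr1n mul1r expr0 mulr1 coefXn eqxx mulr1.
Qed.

(** Along the branch, the relation compares [m_j + n m_k + p] with [n e], where
    [e = m_i + m_j + m_k] and [m] is the monomial of least order in [R]. *)
Lemma reduced_form_pole e d c R U U' T T' p P :
    P 0 j = 0 -> P 0 k = 0 ->
    R \is e.-homog -> (forall m, m \in msupp R -> (m j < n)%N) -> R != 0 ->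
    U \is c.-homog -> U' \is c.-homog -> ev U P != 0 -> ev U' P != 0 ->
    T' \is d.-homog -> ev T' P != 0 ->
    (forall psi, order0 psi n -> vanishes 2 (at_branch i j psi F) ->
      order0 (at_branch i j psi T) 1) ->
    dvd_form F (R * (U' * T ^+ p) - U * T' ^+ p * 'X_k ^+ e) ->
  exists2 m, m \in msupp R & (p = n * m i + (n - 1) * m j)%N.
Proof.
move=> Pj Pk Re RV R0 Uc Uc' UP UP' Td' TP' oT FR.
have [m m_in Hm] :=
  at_branch_order ijk_uniq R0 (small_exp_inj n_ge3 ijk_uniq (conj Re RV)).
exists m => //.
(* The precision must exceed the common order [n e] and be at least 2 for [oT]. *)
have [psi opsi Fpsi] := branch_exists n_ge3 G_homog ijk_uniq (n * e).+2.
have oU := at_branch_unit n_ge3 ijk_uniq Uc opsi Pj Pk UP.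
have oU' := at_branch_unit n_ge3 ijk_uniq Uc' opsi Pj Pk UP'.
have oT' := at_branch_unit n_ge3 ijk_uniq Td' opsi Pj Pk TP'.
have {}oT := oT psi opsi (vanishesW (isT : (2 <= (n * e).+2)%N) Fpsi).
have := at_branch_dvd Fpsi FR.
rewrite rmorphB !rmorphM !rmorphXn /= (at_branchX ijk_uniq) => cong.
have o1 := order0M (Hm psi opsi) (order0M oU' (order0_exp p oT)).
have o2 := order0M (order0M oU (order0_exp p oT')) (order0_exp e opsi).
have {}cong := vanishesN cong; rewrite opprB in cong.
rewrite mul0n !add0n mul1n in o1 o2.
have eq_o := order0_uniq o1 (order0_cong o2 cong (leqnSn _)).
have deg_m := dhomogP _ _ _ Re m m_in; rewrite /= (mdeg3 ijk_uniq) in deg_m.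
by clear -eq_o deg_m n_ge3; nia.
Qed.

Lemma semigroup_monomial_pole P m : P 0 i != 0 -> P 0 j = 0 -> P 0 k = 0 ->
  weierstrass_semigroup F P m -> monomial_pole n m.
Proof.
move=> Pi Pj Pk [f [A [B [[[d Ad Bd] ->] nB]]] pole].
have [->|m_gt0] := posnP m; first by exists 0%N, 0%N; rewrite !muln0.
have reg Q : on_curve F Q -> ~~ (P == Q)%MS -> regular_at F Q (A%:F / B%:F).
  by move=> FQ /negPf PQ; have := pole Q FQ; rewrite /mult_point PQ => -[[]|[]].
have [|e [C [Ce FC]]] := regular_affine Ad Bd nB.
  move=> Q FQ Qk; apply: reg => //.
  by rewrite (same_pointE ijk_uniq Pi Pj Pk FQ.1) negb_and Qk orbT.
have [R [Re RV] FCR] := normal_form n_ge3 G_homog ijk_uniq Ce.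
have FR : dvd_form F (A * 'X_k ^+ e - R * B).
  have ->: A * 'X_k ^+ e - R * B = (A * 'X_k ^+ e - C * B) + (C - R) * B by ring.
  by apply: dvd_formD => //; apply: dvd_formMr.
have Xe : 'X_k ^+ e \is [in K[3], e.-homog] by solve_homog.
(* Regularity at [(0 : 1 : 0)], which is not [P], excludes positive powers of [X_j / X_k]. *)
have RV2 u : u \in msupp R -> u i = 0%N -> u j = 0%N.
  pose Q : 'rV[K]_3 := \row_l coords3 i j 0 1 0 l.
  have [Qi Qj Qk] : [/\ Q 0 i = 0, Q 0 j = 1 & Q 0 k = 0].
    by rewrite !mxE !(coords3E ijk_uniq).
  have FQ : on_curve F Q.
    split; last by rewrite (ev_cyclic_eq _ _ _ n_ge3) // Qi mul0r.
    by apply/eqP => Q0; move: Qj; rewrite Q0 mxE => /esym/eqP; rewrite oner_eq0.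
  have [|c [C' [D [Cc Dc DQ FD]]]] :=
    regular_at_dvd n_ge3 G_homog ijk_uniq Ad Bd nB (reg Q FQ _).
    by rewrite (same_pointE ijk_uniq Pi Pj Pk FQ.1) negb_and Qj oner_eq0.
  apply: (regular_reduced_form (conj Re RV) Cc Dc Qi Qk DQ).
  exact: (dvd_form_cross n_ge3 G_homog ijk_uniq Ad Bd Re Xe Cc Dc nB FR FD).
have P0 : P != 0 by apply: contraNneq Pi => ->; rewrite mxE.
have FP : on_curve F P.
  by split=> //; apply: (ev_cyclic_eq_centre G i n_ge3 Pj Pk).
have PP : (P == P)%MS.
  by rewrite (same_pointE ijk_uniq Pi Pj Pk P0) Pj Pk eqxx.
have := pole P FP; rewrite /mult_point PP => -[[m0 _]|[_]].
  by rewrite m0 in m_gt0.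
move=> [t [u [unif_t [U [U' [[[c Uc Uc'] ->] UP' UP]]] eq_f]]].
have [b [T [T' [Tb Tb' def_t TP' oT]]]] :=
  at_branch_uniformizer n_ge3 G_homog ijk_uniq Pi Pj Pk unif_t.
move: eq_f; rewrite def_t frac_expN mulf_div -!tofracM => eq_f.
have T0 : T != 0.
  have [psi opsi Fpsi] := branch_exists n_ge3 G_homog ijk_uniq 2.
  have [T1 _] := oT psi opsi Fpsi.
  by apply: contraNneq T1 => ->; rewrite rmorph0 coef0.
have h1 : U * T' ^+ m \is (c + b * m).-homog by solve_homog.
have h2 : U' * T ^+ m \is (c + b * m).-homog by solve_homog.
have FT := ratfun_eq_dvd n_ge3 G_homog ijk_uniq Ad Bd h1 h2 (ndvd_form_neq0 nB) _ eq_f.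
have {}FT : dvd_form F (A * (U' * T ^+ m) - U * T' ^+ m * B).
  by apply: FT; rewrite mulf_neq0 ?expf_neq0 // (ev_neq0 UP').
have FRT := dvd_form_cross n_ge3 G_homog ijk_uniq Ad Bd Re Xe h1 h2 nB FR FT.
(* If [R] were 0, [F] would divide a product of forms none of which it divides. *)
have [R0|R0] := eqVneq R 0.
  have nU := ev_ndvd_form FP.2 UP; have nT' := ev_ndvd_form FP.2 TP'.
  have nX := @ndvd_formXU K n G i j k n_ge3 ijk_uniq k.
  have nT'm : ~ dvd_form F (T' ^+ m).
    exact: (ndvd_formXn n_ge3 G_homog ijk_uniq Tb' nT').
  have nXe : ~ dvd_form F ('X_k ^+ e).
    exact: (ndvd_formXn n_ge3 G_homog ijk_uniq (dhomogXU _ k) nX).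
  have nUT : ~ dvd_form F (U * T' ^+ m).
    by apply: (ndvd_formM n_ge3 G_homog ijk_uniq Uc _ nU nT'm (e := b * m)); solve_homog.
  case: (ndvd_formM n_ge3 G_homog ijk_uniq h1 Xe nUT nXe).
  by move: (dvd_formN FRT); rewrite R0 mul0r sub0r opprK.
have RV3 v : v \in msupp R -> (v j < n)%N.
  by move=> v_in; case: (RV v v_in) => // /(RV2 v v_in) ->; clear -n_ge3; lia.
have [v v_in ->] := reduced_form_pole Pj Pk Re RV3 R0 Uc Uc' UP UP' Tb' TP' oT FRT.
exists (v i), (v j); split=> //.
(* The bound on [v j] is trivial if [v i = 0], where [v j = 0]; otherwise [v j <= n - 1]
   suffices. *)
have lt_vj := RV3 _ v_in; have [vi|vi] := posnP (v i).
  by rewrite (RV2 v v_in vi).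
by clear -lt_vj vi; nia.
Qed.

Lemma weierstrass_semigroupE P m : P 0 i != 0 -> P 0 j = 0 -> P 0 k = 0 ->
  weierstrass_semigroup F P m <-> monomial_pole n m.
Proof.
move=> Pi Pj Pk; split; first exact: semigroup_monomial_pole.
exact: (monomial_pole_semigroup n_ge3 G_homog ijk_uniq Pi Pj Pk).
Qed.

End PolesAtCentre.

Theorem theorem3p1 (K : closedFieldType) (n : nat) (G : {mpoly K[3]})
    (hn : (3 <= n)%N)
    (hG : G = 0 \/ G \is (n - 2).-homog)
    (hF : nonsingular (curve_eq n G))
    (P : 'rV[K]_3)
    (hP : P \in [:: hpoint 1 0 0; hpoint 0 1 0; hpoint 0 0 1]) :
  (forall m : nat,
     gap (curve_eq n G) P m <->
     exists i j : nat,
       (1 <= i <= j)%N /\ (j <= n - 1)%N /\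
       m = ((i - 1) * (n - 1) + j)%N) /\
  (forall m : nat,
     weierstrass_semigroup (curve_eq n G) P m <->
     generated
       (fun k => exists s : nat, (1 <= s <= n)%N /\ k = (s * (n - 1) + 1)%N) m).
Proof.
have G_homog : G \is (n - 2).-homog by case: hG => [->|//]; apply: dhomog0.
have semigroupE m : weierstrass_semigroup (curve_eq n G) P m <-> monomial_pole n m.
  (* The three points correspond to the three rotations of [(0, 1, 2)], which leave the equation
     unchanged. *)
  rewrite -[curve_eq n G]/(cyclic_eq n G 0 1 2).
  move: hP; rewrite !inE => /or3P[]/eqP->.
  - by apply: weierstrass_semigroupE; rewrite // !mxE //= oner_neq0.
  - rewrite -cyclic_eq_rot.
    by apply: weierstrass_semigroupE; rewrite // !mxE //= oner_neq0.
  - rewrite -2!cyclic_eq_rot.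
    by apply: weierstrass_semigroupE; rewrite // !mxE //= oner_neq0.
split=> m; last first.
  by rewrite semigroupE generated_monomial_pole.
by rewrite /gap semigroupE not_monomial_pole.
Qed.
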